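(* Let $\sigma>0$ and let $X=\{x_i:i\in\mathbb{Z}\}$, $\cdots<x_{i-1}<x_i<x_{i+1}<\cdots$, be a sequence of real numbers such that $\sup_{i\in\mathbb{Z}}(x_{i+1}-x_i)\le\frac{2\pi}{\sigma}$. Then $X$ is a set of uniqueness of order $1$ for $\mathcal{B}_\sigma$, i.e., if $f\in\mathcal{B}_\sigma$ satisfies $f(x_i)=f'(x_i)=0$ for all $i\in\mathbb{Z}$, then $f\equiv0$.
   Context: The Fourier transform is $\widehat f(w)=\int_{\mathbb{R}} f(x)e^{-2\pi i w x}\,\mathrm{d}x$, extended to $L^2(\mathbb{R})$. For $\sigma>0$, $\mathcal{B}_\sigma=\{f\in L^2(\mathbb{R}):\operatorname{supp}\widehat f\subseteq[-\frac{\sigma}{2\pi},\frac{\sigma}{2\pi}]\}$; its elements are identified with entire functions of exponential type $\le\sigma$ that are square integrable on the real axis. *)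

(* Defs.v *)
From mathcomp Require Import all_boot all_order all_algebra.
From mathcomp Require Import complex.
From mathcomp Require Import all_classical all_reals all_analysis.

Set Implicit Arguments.
Unset Strict Implicit.
Unset Printing Implicit Defensive.

Import Order.TTheory GRing.Theory Num.Theory.
Import numFieldNormedType.Exports.

Local Open Scope classical_set_scope.
Local Open Scope ring_scope.
Local Open Scope complex_scope.

Section ComplexValued.
Variable R : realType.
Local Notation mu := (@lebesgue_measure R).

Implicit Types (f g : R -> R[i]) (p : \bar R) (x w t : R).

Definition cRe f : R -> R := fun x => complex.Re (f x).
Definition cIm f : R -> R := fun x => complex.Im (f x).

Definition ccontinuous f : Prop := continuous (cRe f) /\ continuous (cIm f).

(* Meaningful only when both components are derivable at [x]. *)
Definition cderive f : R -> R[i] :=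
  fun x => derive1 (cRe f) x +i* derive1 (cIm f) x.

Definition cintegral f : R[i] :=
  Rintegral mu setT (cRe f) +i* Rintegral mu setT (cIm f).

Definition cLp p f : Prop := cRe f \in Lfun mu p /\ cIm f \in Lfun mu p.

Definition L2dist f g : \bar R :=
  Lnorm mu 2%:E (fun x => (Normc.normc (f x - g x))%:E).

Definition expi t : R[i] := cos t +i* sin t.

Definition fourier f : R -> R[i] :=
  fun w => cintegral (fun x => f x * expi (- (2 * pi * w * x))).

(* The extension to L2 by density: [g] is an L2 limit of the transforms of
   some functions in the intersection of L1 and L2 that tend to [f] in L2. *)
Definition is_fourierL2 f g : Prop :=
  [/\ cLp 2%:E f, cLp 2%:E g &
    exists u : nat -> R -> R[i],
      [/\ forall n, cLp 1 (u n) /\ cLp 2%:E (u n),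
          L2dist (u n) f @[n --> \oo] --> 0%E &
          L2dist (fourier (u n)) g @[n --> \oo] --> 0%E]].

(* Support of an almost-everywhere class: the complement of the largest open
   set on which [g] vanishes almost everywhere. *)
Definition ess_support g : set R :=
  [set w | forall U : set R, nbhs w U ->
    ~ {ae mu, forall t, U t -> g t = 0}].

(* By the Paley-Wiener theorem an L2 class with spectrum in a compact interval
   has exactly one continuous representative, namely the restriction to the
   real axis of the entire function that the class is identified with; the
   elements of the space are these representatives. Continuity is enough to
   single them out. *)
Definition bandlimited (sigma : R) : set (R -> R[i]) :=
  [set f | ccontinuous f /\
    exists2 g, is_fourierL2 f g &
      ess_support g `<=` `[- (sigma / (2 * pi)), sigma / (2 * pi)]].

Definition uniqueness_set_order1 (X : set R) (V : set (R -> R[i])) : Prop :=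
  forall f, V f -> (forall x, X x -> f x = 0 /\ cderive f x = 0) ->
    forall t, f t = 0.

End ComplexValued.

(* Main.v *)
(* Let f be the inverse transform of g, supported in |w| <= sigma / (2 pi), and
   let m(w) = (2 pi w)^2. On a gap of length at most 2 pi / sigma at whose ends
   f and f' vanish, f' has mean zero and equal values at the ends, so Wirtinger's
   inequality gives  - int f f'' = int f'^2 <= sigma^-2 int f''^2.  If the points
   are unbounded in both directions, the gaps cover the line; summing, and
   using Plancherel's identity for - int f f'' and inequality for int f''^2,
       int m |g|^2 <= sigma^-2 int m^2 |g|^2,
   while m <= sigma^2 on the spectrum: hence g = 0 almost everywhere. Otherwise
   the zeros cluster at a point, where by Rolle's theorem all derivatives
   of f vanish, and f = 0 since the n-th derivative is O(sigma^n).
   Plancherel's identity is only needed for the pairing of f with f'', and this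
   is the multiplication formula int (F u) phi = int u (F phi) passed to the
   L2 limit. Complex functions are handled through their real and imaginary
   parts, and the Fourier transform through cosine and sine transforms. *)

Require Import Defs.
From mathcomp Require Import all_boot all_order all_algebra.
From mathcomp Require Import complex.
From mathcomp Require Import all_classical all_reals all_analysis.
From mathcomp Require Import measurable_realfun zify ring lra.

Set Implicit Arguments.
Unset Strict Implicit.
Unset Printing Implicit Defensive.

Import Order.TTheory GRing.Theory Num.Theory.
Import numFieldNormedType.Exports.

Local Open Scope classical_set_scope.
Local Open Scope ring_scope.

(** * Integrable functions on the real line *)

(** Why Wirtinger is applied to f' and not to f: vanishing ends alone give the constant pi / gap,
    whereas mean zero with equal end values gives 2 pi / gap, which is what gaps as long as 2 pi /
    sigma require. At that length the estimate has no slack. Strictness comes from the spectral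
    side, where m (sigma^2 - m) vanishes only at w = 0 and at the two ends of the band, a null set.
    The obstacle is that f is tied to g only through an L2 limit, so that f is the inverse transform
    of g has to be proved. The multiplication formula is tested on exp(- e |w|) times a cosine or a
    sine, whose transforms are combinations of shifted Poisson kernels. This kernel is nonnegative,
    of mass 1, and concentrates as e tends to 0: concentration yields pointwise inversion for
    continuous f, and positivity with unit mass yields the Plancherel inequality. An inequality
    suffices for f'' because int f''^2 enters the balance only as an upper bound. *)

Section Integrable.
Variable R : realType.
Local Notation mu := (@lebesgue_measure R).
Local Notation L1 f := (mu.-integrable setT (EFin \o f)).
Implicit Types f g h : R -> R.

Lemma L1_measurable f : L1 f -> measurable_fun setT f.
Proof. by move=> /integrableP[/measurable_EFinP]. Qed.

Lemma L1_le f g : measurable_fun setT f -> (forall x, `|f x| <= g x) ->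
  L1 g -> L1 f.
Proof.
move=> mf fg; apply: le_integrable => //; first exact/measurable_EFinP.
by move=> x _ /=; rewrite lee_fin (le_trans (fg x))// ler_norm.
Qed.

Lemma L1D f g : L1 f -> L1 g -> L1 (fun x => f x + g x).
Proof. by move=> Lf Lg; exact: (integrableD measurableT Lf Lg). Qed.

Lemma L1B f g : L1 f -> L1 g -> L1 (fun x => f x - g x).
Proof. by move=> Lf Lg; exact: (integrableB measurableT Lf Lg). Qed.

Lemma L1Z k f : L1 f -> L1 (fun x => k * f x).
Proof. by move=> Lf; exact: (integrableZl measurableT _ Lf). Qed.

Lemma L1N f : L1 f -> L1 (fun x => - f x).
Proof. by move=> Lf; exact: (integrableN Lf). Qed.

Lemma L1_norm f : L1 f -> L1 (fun x => `|f x|).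
Proof. by move=> Lf; apply: integrable_norm. Qed.

Lemma L1M_bounded f h (M : R) : L1 f -> measurable_fun setT h ->
  (forall x, `|h x| <= M) -> L1 (fun x => f x * h x).
Proof.
move=> Lf mh hM; apply: (@L1_le _ (fun x => M * `|f x|)).
- by apply: measurable_funM => //; exact: L1_measurable.
- by move=> x; rewrite normrM mulrC ler_wpM2r.
- exact/L1Z/L1_norm.
Qed.

Lemma sqr_L1M f g : measurable_fun setT f -> measurable_fun setT g ->
  L1 (fun x => f x ^+ 2) -> L1 (fun x => g x ^+ 2) ->
  L1 (fun x => f x * g x).
Proof.
move=> mf mg Lf Lg; apply: (@L1_le _ (fun x => f x ^+ 2 + g x ^+ 2)).
- exact: measurable_funM.
- move=> x; rewrite normrM -(real_normK (num_real (f x))).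
  rewrite -(real_normK (num_real (g x))).
  by have := sqr_ge0 (`|f x| - `|g x|); have := normr_ge0 (f x);
    have := normr_ge0 (g x); nra.
- exact: L1D.
Qed.

Lemma int_ge0 f : (forall x, 0 <= f x) -> 0 <= \int[mu]_x f x.
Proof. by move=> f0; apply: Rintegral_ge0. Qed.

Lemma le_int f g : L1 f -> L1 g -> (forall x, f x <= g x) ->
  \int[mu]_x f x <= \int[mu]_x g x.
Proof. by move=> Lf Lg fg; apply: le_Rintegral. Qed.

Lemma EFin_int f : L1 f -> (\int[mu]_x f x)%:E = (\int[mu]_x (f x)%:E)%E.
Proof. by move=> Lf; rewrite /Rintegral fineK//; exact: integrable_fin_num. Qed.

Lemma ge0_L1 f : measurable_fun setT f -> (forall x, 0 <= f x) ->
  (\int[mu]_x (f x)%:E < +oo)%E -> L1 f.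
Proof.
move=> mf f0 foo; apply/integrableP; split; first exact/measurable_EFinP.
by under eq_integral do rewrite /= ger0_norm//.
Qed.

Lemma normr_int_le f g : L1 f -> L1 g -> (forall x, `|f x| <= g x) ->
  `|\int[mu]_x f x| <= \int[mu]_x g x.
Proof.
move=> Lf Lg fg; apply: le_trans (le_normr_Rintegral _ Lf) _ => //.
by apply: le_Rintegral => //; exact: L1_norm.
Qed.

(* AM-GM with weight [s], used in place of the Cauchy-Schwarz inequality. *)
Lemma small_pairing (d g : R -> R) (s : R) : 0 < s ->
  measurable_fun setT d -> measurable_fun setT g ->
  L1 (fun x => d x ^+ 2) -> L1 (fun x => g x ^+ 2) ->
  \int[mu]_x (d x ^+ 2) <= s ^+ 2 ->
  `|\int[mu]_x (d x * g x)| <= s * (1 + \int[mu]_x (g x ^+ 2)).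
Proof.
move=> s0 md mg Ld Lg ds.
apply: (@le_trans _ _ (\int[mu]_x (s^-1 * d x ^+ 2 + s * g x ^+ 2))).
  apply: normr_int_le; first exact: sqr_L1M.
    by apply: L1D; apply: L1Z.
  move=> x; rewrite normrM -(real_normK (num_real (d x))).
  rewrite -(real_normK (num_real (g x))) -(ler_pM2l s0) mulrDr !mulrA.
  rewrite divff ?gt_eqF// mul1r.
  have := sqr_ge0 (`|d x| - s * `|g x|); have := normr_ge0 (d x).
  by have := mulr_ge0 (ltW s0) (normr_ge0 (g x)); nra.
rewrite RintegralD//; [|exact: L1Z..].
rewrite !RintegralZl// mulrDr mulr1 lerD2r ler_pdivrMl//.
Qed.

End Integrable.

(** * Calculus on segments *)

Section Calculus.
Variable R : realType.
Local Notation mu := (@lebesgue_measure R).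
Implicit Types (f g : R -> R) (a b c x k : R).

Lemma is_derive1D f g x df dg : is_derive x 1 f df -> is_derive x 1 g dg ->
  is_derive x 1 (fun t => f t + g t) (df + dg).
Proof. by move=> hf hg; exact: is_deriveD. Qed.

Lemma is_derive1B f g x df dg : is_derive x 1 f df -> is_derive x 1 g dg ->
  is_derive x 1 (fun t => f t - g t) (df - dg).
Proof. by move=> hf hg; exact: is_deriveB. Qed.

Lemma is_derive1M f g x df dg : is_derive x 1 f df -> is_derive x 1 g dg ->
  is_derive x 1 (fun t => f t * g t) (df * g x + f x * dg).
Proof.
move=> hf hg; apply: (is_derive_eq (is_deriveM hf hg)).
by rewrite addrC mulrC.
Qed.

Lemma is_derive1Z k f x df : is_derive x 1 f df ->
  is_derive x 1 (fun t => k * f t) (k * df).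
Proof. by move=> hf; exact: is_deriveZ. Qed.

Lemma is_derive1_affine k c x : is_derive x 1 (fun t => k * t + c) k.
Proof.
have h1 := is_derive1Z k (is_derive_id x 1).
have := is_derive1D h1 (is_derive_cst c x 1).
by rewrite addr0 mulr1.
Qed.

Lemma is_derive1_comp_affine f k c x df : is_derive (k * x + c) 1 f df ->
  is_derive x 1 (fun t => f (k * t + c)) (k * df).
Proof.
move=> hf; rewrite mulrC.
exact: (@is_derive1_comp _ f (fun t => k * t + c) x _ _ hf (is_derive1_affine _ _ _)).
Qed.

Lemma is_derive1_continuous f x df : is_derive x 1 f df -> {for x, continuous f}.
Proof. by move=> [hf _]; exact/differentiable_continuous/derivable1_diffP. Qed.

Lemma FTC_segment F f a b : a < b ->
  (forall x, x \in `[a, b] -> is_derive x 1 F (f x)) ->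
  (forall x, x \in `[a, b] -> {for x, continuous f}) ->
  \int[mu]_(x in `[a, b]) f x = F b - F a.
Proof.
move=> ab dF cf; rewrite /Rintegral (@continuous_FTC2 _ _ F)//=.
- by apply: continuous_in_subspaceT => x; rewrite inE; exact: cf.
- split.
  + move=> x xab; have [] // := dF x _.
    by move: xab; rewrite !in_itv/= => /andP[/ltW-> /ltW->].
  + apply: cvg_at_right_filter; apply: is_derive1_continuous.
    by apply: dF; rewrite in_itv/= lexx ltW.
  + apply: cvg_at_left_filter; apply: is_derive1_continuous.
    by apply: dF; rewrite in_itv/= lexx ltW.
- move=> x xab; rewrite derive1E; have [] // := dF x _.
  by move: xab; rewrite !in_itv/= => /andP[/ltW-> /ltW->].
Qed.

Lemma continuous_segment_integrable f a b :
  (forall x, x \in `[a, b] -> {for x, continuous f}) ->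
  mu.-integrable `[a, b] (EFin \o f).
Proof.
move=> cf; apply: continuous_compact_integrable; first exact: segment_compact.
by apply: continuous_in_subspaceT => x; rewrite inE; exact: cf.
Qed.

Lemma continuousT_segment_integrable f a b : continuous f ->
  mu.-integrable `[a, b] (EFin \o f).
Proof. by move=> cf; apply: continuous_segment_integrable => x _; exact: cf. Qed.

Lemma FTC_segmentT F f a b : a < b -> (forall x, is_derive x 1 F (f x)) ->
  continuous f -> \int[mu]_(x in `[a, b]) f x = F b - F a.
Proof. by move=> ab dF cf; apply: FTC_segment => // x _; exact: cf. Qed.

Lemma int_segment_reflect f a b : a < b -> continuous f ->
  \int[mu]_(x in `[a, b]) f (-1 * x + (a + b)) = \int[mu]_(x in `[a, b]) f x.
Proof.
move=> ab cf; rewrite /Rintegral; congr fine.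
pose r : R -> R := fun x => -1 * x + (a + b).
have dr (x : R) : is_derive x 1 r (-1) by exact: is_derive1_affine.
have rE : (r^`())%classic = cst (-1) by apply/funext => x; rewrite derive1E derive_val.
have rb : r b = a by rewrite /r; ring.
have ra : r a = b by rewrite /r; ring.
have := @integration_by_substitution_decreasing R r f a b (ltW ab).
rewrite rb ra rE => -> //.
- by apply: eq_integral => x _ /=; rewrite !fctE opprK mulr1.
- by move=> x y _ _ xy; rewrite /r; lra.
- by move=> x _; exact: cvg_cst.
- exact: is_cvg_cst.
- exact: is_cvg_cst.
- split=> [x _||].
  + by have [] := dr x.
  + by apply: cvg_at_right_filter; apply: is_derive1_continuous.
  + by apply: cvg_at_left_filter; apply: is_derive1_continuous.
- exact: continuous_subspaceT.
Qed.

End Calculus.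

(** * Wirtinger's inequality for clamped functions *)

Section Wirtinger.
Variable R : realType.
Local Notation mu := (@lebesgue_measure R).
Implicit Types (f g u v : R -> R) (a b c x k : R).

Lemma continuous_fD f g : continuous f -> continuous g ->
  continuous (fun x => f x + g x).
Proof. by move=> cf cg x; apply: cvgD; [exact: cf|exact: cg]. Qed.

Lemma continuous_fB f g : continuous f -> continuous g ->
  continuous (fun x => f x - g x).
Proof. by move=> cf cg x; apply: cvgB; [exact: cf|exact: cg]. Qed.

Lemma continuous_fM f g : continuous f -> continuous g ->
  continuous (fun x => f x * g x).
Proof. by move=> cf cg x; apply: cvgM; [exact: cf|exact: cg]. Qed.

Lemma continuous_fZ k f : continuous f -> continuous (fun x => k * f x).
Proof. by move=> cf x; apply: cvgM; [exact: cvg_cst|exact: cf]. Qed.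

Lemma continuous_fX f : continuous f -> continuous (fun x => f x ^+ 2).
Proof. by move=> cf; exact: continuous_fM. Qed.

Lemma continuous_comp_affine f k c : continuous f ->
  continuous (fun x => f (k * x + c)).
Proof.
move=> cf x; apply: (@continuous_comp _ _ _ (fun t => k * t + c) f); last exact: cf.
by apply: is_derive1_continuous; exact: is_derive1_affine.
Qed.

(* Jacobi's identity: with p = - k tan(k(x - c)), c the midpoint of the
   interval, p' = - k^2 - p^2 and v'^2 - k^2 v^2 = (v' - p v)^2 + (p v^2)'. *)
Lemma wirtinger_dirichlet_lt k v v' a b : a < b -> 0 < k -> k * (b - a) < pi ->
  (forall x, is_derive x 1 v (v' x)) -> continuous v' -> v a = 0 -> v b = 0 ->
  k ^+ 2 * \int[mu]_(x in `[a, b]) (v x ^+ 2) <=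
  \int[mu]_(x in `[a, b]) (v' x ^+ 2).
Proof.
move=> ab k0 kab dv cv' va vb.
have cv : continuous v by move=> x; exact: is_derive1_continuous.
pose c : R := - (k * ((a + b) / 2)).
pose T : R -> R := fun x => tan (k * x + c).
(* The phase is k times the distance to the midpoint, at most k (b - a) / 2 in modulus; the strict
   bound by pi / 2 keeps the closed segment away from the poles of the tangent. *)
have cosT x : x \in `[a, b] -> cos (k * x + c) != 0.
  rewrite in_itv/= => /andP[ax xb]; rewrite gt_eqF// cos_gt0_pihalf//.
  have := ler_wpM2l (ltW k0) ax; have := ler_wpM2l (ltW k0) xb.
  by rewrite /c; move: kab; rewrite mulrBr; move=> *; apply/andP; split; lra.
have dT x : x \in `[a, b] -> is_derive x 1 T (k * (1 + T x ^+ 2)).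
  move=> xab; apply: is_derive1_comp_affine.
  by rewrite -cos2_tan2 ?cosT//; apply: is_derive_tan; exact: cosT.
have cT x : x \in `[a, b] -> {for x, continuous T}.
  by move=> /dT /is_derive1_continuous.
pose F : R -> R := fun x => - k * (v x ^+ 2 * T x).
pose G : R -> R := fun x => - k * ((v' x * v x + v x * v' x) * T x +
   v x ^+ 2 * (k * (1 + T x ^+ 2))).
have cG x : x \in `[a, b] -> {for x, continuous G}.
  move=> xab; have Tx := cT _ xab; have vx := cv x; have v'x := cv' x.
  apply: cvgM; first exact: cvg_cst.
  apply: cvgD.
    by apply: cvgM => //; apply: cvgD; apply: cvgM.
  apply: cvgM; first exact: cvgM.
  apply: cvgM; first exact: cvg_cst.
  by apply: cvgD; [exact: cvg_cst|exact: cvgM].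
have dF x : x \in `[a, b] -> is_derive x 1 F (G x).
  move=> xab; apply: is_derive1Z; apply: is_derive1M (dT _ xab).
  exact: is_derive1M.
have IG : \int[mu]_(x in `[a, b]) G x = 0.
  by rewrite (FTC_segment ab dF cG) /F va vb; ring.
rewrite -RintegralZl//; last first.
  by apply: continuousT_segment_integrable; exact: continuous_fX.
rewrite -[leLHS]addr0 -IG -RintegralD//; last 2 first.
- by apply: continuousT_segment_integrable; exact/continuous_fZ/continuous_fX.
- exact: continuous_segment_integrable.
apply: le_Rintegral => //.
- apply: continuous_segment_integrable => x xab; apply: cvgD; last exact: cG.
  exact: (@continuous_fZ (k ^+ 2) _ (continuous_fX cv) x).
- by apply: continuousT_segment_integrable; exact: continuous_fX.
- move=> x _; rewrite /G -subr_ge0.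
  rewrite (_ : _ - _ = (v' x + k * T x * v x) ^+ 2); first exact: sqr_ge0.
  by ring.
Qed.

(** At the critical rate pi / (b - a) the tangent has poles at both ends, so the inequality is
    reached as the limit of the rates t pi / (b - a) with t < 1. *)
Lemma wirtinger_dirichlet v v' a b : a < b ->
  (forall x, is_derive x 1 v (v' x)) -> continuous v' -> v a = 0 -> v b = 0 ->
  (pi / (b - a)) ^+ 2 * \int[mu]_(x in `[a, b]) (v x ^+ 2) <=
  \int[mu]_(x in `[a, b]) (v' x ^+ 2).
Proof.
move=> ab dv cv' va vb.
set A := Rintegral _ _ _; set B := Rintegral _ _ _.
have A0 : 0 <= A by apply: Rintegral_ge0 => x _; exact: sqr_ge0.
have B0 : 0 <= B by apply: Rintegral_ge0 => x _; exact: sqr_ge0.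
have ba0 : 0 < b - a by rewrite subr_gt0.
have K0 : 0 < pi / (b - a) :> R by rewrite divr_gt0// pi_gt0.
set K := pi / (b - a) in K0 *.
have h t : 0 < t -> t < 1 -> t ^+ 2 * (K ^+ 2 * A) <= B.
  move=> t0 t1; rewrite mulrA -exprMn; apply: wirtinger_dirichlet_lt => //.
    exact: mulr_gt0.
  by rewrite -mulrA /K divfK ?gt_eqF// gtr_pMl// pi_gt0.
set C := K ^+ 2 * A in h *.
rewrite leNgt; apply/negP => BC.
have C0 : 0 < C by exact: le_lt_trans BC.
pose r := B / C.
have rC : r * C = B by rewrite /r divfK// gt_eqF.
have r0 : 0 <= r by rewrite divr_ge0// ltW.
have r1 : r < 1 by rewrite /r ltr_pdivrMr// mul1r.
(* If B < C, the factor t = (1 + r) / 2 is below 1 while t^2 exceeds r = B / C, since t^2 - r = ((1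
   - r) / 2)^2. *)
have := h ((1 + r) / 2); rewrite -rC ler_pM2r// => h'.
suff : 0 < (1 - r) ^+ 2 by have := h'; nra.
by rewrite exprn_gt0// subr_gt0.
Qed.

Lemma int_segment_split (k : R -> R) (a m b : R) : a <= m -> m <= b ->
  mu.-integrable `[a, b] (EFin \o k) ->
  \int[mu]_(t in `[a, b]) k t =
  \int[mu]_(t in `[a, m]) k t + \int[mu]_(t in `[m, b]) k t.
Proof.
move=> am mb ik.
have := @Rintegral_itvB _ k (BLeft a) (BRight b) m ik.
rewrite !bnd_simp => /(_ am mb) H.
rewrite -(@Rintegral_itv_obnd_cbnd _ m (BRight b)).
  by rewrite -H addrC subrK.
apply: integrableS ik => //; apply: subset_itvr; rewrite bnd_simp.
exact: am.
Qed.

(* Decompose [f] into its parts even and odd about the midpoint: the derivative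
   of the former and the latter itself vanish at the midpoint and at the ends. *)
Lemma wirtinger_clamped f f' f'' a b : a < b ->
  (forall x, is_derive x 1 f (f' x)) -> (forall x, is_derive x 1 f' (f'' x)) ->
  continuous f'' -> f a = 0 -> f b = 0 -> f' a = 0 -> f' b = 0 ->
  (2 * pi / (b - a)) ^+ 2 * \int[mu]_(x in `[a, b]) (f' x ^+ 2) <=
  \int[mu]_(x in `[a, b]) (f'' x ^+ 2).
Proof.
move=> ab df df' cf'' fa fb f'a f'b.
have cf' : continuous f' by move=> x; exact: is_derive1_continuous.
have cf : continuous f by move=> x; exact: is_derive1_continuous.
pose m := (a + b) / 2; pose r : R -> R := fun x => -1 * x + (a + b).
have am : a < m by rewrite /m; lra.
have mb : m < b by rewrite /m; lra.
have ra : r a = b by rewrite /r; ring.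
have rb : r b = a by rewrite /r; ring.
have rm : r m = m by rewrite /r /m; lra.
have dr g g' x : (forall x, is_derive x 1 g (g' x)) ->
    is_derive x 1 (fun t => g (r t)) (-1 * g' (r x)).
  by move=> dg; exact: is_derive1_comp_affine.
have cr g : continuous g -> continuous (fun t => g (r t)).
  exact: continuous_comp_affine.
set K := 2 * pi / (b - a).
have K0 : 0 < K by rewrite divr_gt0// ?subr_gt0// mulr_gt0// pi_gt0.
(* A zero at the midpoint allows the Dirichlet inequality on each half, whose length (b - a) / 2
   doubles the constant. *)
have half v v' : (forall x, is_derive x 1 v (v' x)) -> continuous v' ->
    v a = 0 -> v m = 0 -> v b = 0 ->
    K ^+ 2 * \int[mu]_(x in `[a, b]) (v x ^+ 2) <=
    \int[mu]_(x in `[a, b]) (v' x ^+ 2).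
  move=> dv cv' va vm vb.
  have cv : continuous v by move=> x; exact: is_derive1_continuous.
  have -> : K = pi / (m - a).
    have -> : m - a = (b - a) / 2 by rewrite /m; field.
    by rewrite /K; field; rewrite subr_eq0 gt_eqF.
  rewrite !(@int_segment_split _ a m b) ?(ltW am) ?(ltW mb)//; last 2 first.
  - by apply: continuousT_segment_integrable; exact: continuous_fX.
  - by apply: continuousT_segment_integrable; exact: continuous_fX.
  rewrite mulrDr; apply: lerD; first exact: wirtinger_dirichlet.
  have -> : m - a = b - m by rewrite /m; field.
  exact: wirtinger_dirichlet.
(* [O] is twice the odd part of [f], and [E] is the derivative of twice its even part. *)
pose O x := f x - f (r x).
pose O' x := f' x + f' (r x).
pose O'' x := f'' x - f'' (r x).
pose E x := f' x - f' (r x).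
pose E' x := f'' x + f'' (r x).
have dO x : is_derive x 1 O (O' x).
  have := is_derive1B (df x) (dr _ _ x df).
  by rewrite /O' mulN1r opprK.
have dO' x : is_derive x 1 O' (O'' x).
  have := is_derive1D (df' x) (dr _ _ x df').
  by rewrite /O'' mulN1r.
have dE x : is_derive x 1 E (E' x).
  have := is_derive1B (df' x) (dr _ _ x df').
  by rewrite /E' mulN1r opprK.
have cO : continuous O by move=> x; exact: is_derive1_continuous.
have cO' : continuous O' by move=> x; exact: is_derive1_continuous.
have cO'' : continuous O'' by apply: continuous_fB => //; exact: cr.
have cE : continuous E by move=> x; exact: is_derive1_continuous.
have cE' : continuous E' by apply: continuous_fD => //; exact: cr.
have hE : K ^+ 2 * \int[mu]_(x in `[a, b]) (E x ^+ 2) <=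
    \int[mu]_(x in `[a, b]) (E' x ^+ 2).
  by apply: half => //; rewrite /E ?ra ?rb ?rm ?f'a ?f'b subrr.
have hO : K ^+ 2 * \int[mu]_(x in `[a, b]) (O x ^+ 2) <=
    \int[mu]_(x in `[a, b]) (O' x ^+ 2).
  by apply: half => //; rewrite /O ?ra ?rb ?rm ?fa ?fb subrr.
have parts : \int[mu]_(x in `[a, b]) (O' x ^+ 2 + O x * O'' x) = 0.
  have dP x : is_derive x 1 (fun t => O t * O' t) (O' x ^+ 2 + O x * O'' x).
    exact: is_derive1M.
  rewrite (FTC_segmentT ab dP).
    by rewrite /O ra rb fa fb !subrr !mul0r subrr.
  by apply: continuous_fD; [exact: continuous_fX|exact: continuous_fM].
have si g : continuous g -> mu.-integrable `[a, b] (EFin \o g).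
  by move=> cg; exact: continuousT_segment_integrable.
(* [O'] need not vanish at the midpoint, so its bound is derived from that of [O]: by parts and
   AM-GM, 2 int O'^2 = - 2 int O O'' <= K^2 int O^2 + K^-2 int O''^2, and the first term on the
   right is absorbed by one copy of int O'^2. *)
have hO2 : K ^+ 2 * \int[mu]_(x in `[a, b]) (O' x ^+ 2) <=
    \int[mu]_(x in `[a, b]) (O'' x ^+ 2).
  suff : 2 * \int[mu]_(x in `[a, b]) (O' x ^+ 2) <=
      K ^+ 2 * \int[mu]_(x in `[a, b]) (O x ^+ 2) +
      K ^- 2 * \int[mu]_(x in `[a, b]) (O'' x ^+ 2).
    move=> h2; have := le_trans h2 (lerD hO (lexx _)).
    by rewrite mulr2n mulrDl mul1r lerD2l ler_pdivlMl// exprn_gt0.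
  rewrite -!RintegralZl//; [|by apply: si; exact: continuous_fX..].
  rewrite -RintegralD//; [|by apply: si; exact/continuous_fZ/continuous_fX..].
  rewrite -[leLHS]addr0 -[X in _ + X](mulr0 (-2)) -parts.
  rewrite -RintegralZl//; last first.
    by apply: si; apply: continuous_fD; [exact: continuous_fX|exact: continuous_fM].
  rewrite -RintegralD//; last 2 first.
  - by apply: si; exact/continuous_fZ/continuous_fX.
  - by apply: si; apply: continuous_fZ; apply: continuous_fD;
      [exact: continuous_fX|exact: continuous_fM].
  apply: le_Rintegral => //.
  - apply: si; apply: continuous_fD; first exact/continuous_fZ/continuous_fX.
    by apply: continuous_fZ; apply: continuous_fD;
      [exact: continuous_fX|exact: continuous_fM].
  - by apply: si; apply: continuous_fD; exact/continuous_fZ/continuous_fX.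
  - move=> x _; rewrite -subr_ge0.
    rewrite (_ : _ - _ = (K * O x + K^-1 * O'' x) ^+ 2); first exact: sqr_ge0.
    by field; rewrite gt_eqF.
(* Parallelogram law together with invariance of the integral under reflection: it reassembles the
   two parts. *)
have sqsum g : continuous g ->
    \int[mu]_(x in `[a, b]) ((g x + g (r x)) ^+ 2) +
    \int[mu]_(x in `[a, b]) ((g x - g (r x)) ^+ 2) =
    4 * \int[mu]_(x in `[a, b]) (g x ^+ 2).
  move=> cg; have cgr := cr g cg.
  rewrite -RintegralD//; last 2 first.
  - by apply: si; apply/continuous_fX/continuous_fD.
  - by apply: si; apply/continuous_fX/continuous_fB.
  have -> : 4 * \int[mu]_(x in `[a, b]) (g x ^+ 2) =
      2 * \int[mu]_(x in `[a, b]) (g x ^+ 2) +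
      2 * \int[mu]_(x in `[a, b]) (g (r x) ^+ 2).
    rewrite (@int_segment_reflect _ (fun x => g x ^+ 2))//; first by ring.
    exact: continuous_fX.
  rewrite -!RintegralZl//; [|by apply: si; exact: continuous_fX..].
  rewrite -RintegralD//; [|by apply: si; exact/continuous_fZ/continuous_fX..].
  by apply: eq_Rintegral => x _; ring.
have := lerD hO2 hE; rewrite -mulrDr sqsum// addrC sqsum// mulrCA ler_pM2l//.
Qed.

(** Integration by parts replaces int f'^2 by - int f f''. In this form, summing over the gaps asks
    for integrability on the line of f''^2 and f f'' only, and f f'' is the pairing that the
    multiplication formula evaluates. *)
Lemma clamped_segment f f' f'' (s : R) a b : a < b -> 0 < s ->
  b - a <= 2 * pi / s ->
  (forall x, is_derive x 1 f (f' x)) -> (forall x, is_derive x 1 f' (f'' x)) ->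
  continuous f'' -> f a = 0 -> f b = 0 -> f' a = 0 -> f' b = 0 ->
  0 <= \int[mu]_(x in `[a, b]) (s ^- 2 * f'' x ^+ 2 + f x * f'' x).
Proof.
move=> ab s0 bas df df' cf'' fa fb f'a f'b.
have cf' : continuous f' by move=> x; exact: is_derive1_continuous.
have cf : continuous f by move=> x; exact: is_derive1_continuous.
have si g : continuous g -> mu.-integrable `[a, b] (EFin \o g).
  by move=> cg; exact: continuousT_segment_integrable.
have parts : \int[mu]_(x in `[a, b]) (f' x ^+ 2 + f x * f'' x) = 0.
  have dP x : is_derive x 1 (fun t => f t * f' t) (f' x ^+ 2 + f x * f'' x).
    exact: is_derive1M.
  rewrite (FTC_segmentT ab dP); first by rewrite fa fb !mul0r subrr.
  by apply: continuous_fD; [exact: continuous_fX|exact: continuous_fM].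
have := wirtinger_clamped ab df df' cf'' fa fb f'a f'b.
set A := Rintegral _ _ _; set B := Rintegral _ _ _ => AB.
have A0 : 0 <= A by apply: Rintegral_ge0 => x _; exact: sqr_ge0.
have sA : s ^+ 2 * A <= B.
  apply: le_trans AB; rewrite ler_wpM2r//.
  have sle : s <= 2 * pi / (b - a).
    by rewrite ler_pdivlMr ?subr_gt0// mulrC -ler_pdivlMr.
  by rewrite lerXn2r// nnegrE ?(ltW s0)// (le_trans (ltW s0)).
rewrite RintegralD//; last 2 first.
- by apply: si; exact/continuous_fZ/continuous_fX.
- by apply: si; exact: continuous_fM.
move: parts; rewrite RintegralD//; last 2 first.
- by apply: si; exact: continuous_fX.
- by apply: si; exact: continuous_fM.
rewrite RintegralZl//; last by apply: si; exact: continuous_fX.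
rewrite -/A -/B => /eqP; rewrite addrC addr_eq0 => /eqP ->.
by rewrite subr_ge0 ler_pdivlMl// exprn_gt0.
Qed.

End Wirtinger.

(** * Functions with geometrically bounded derivatives *)

Section VanishingDerivatives.
Variables (R : realType) (F : nat -> R -> R).
Hypothesis dF : forall (k : nat) (x : R), is_derive x 1 (F k) (F k.+1 x).

Definition zeros_cluster (f : R -> R) (b : R) :=
  forall e : R, 0 < e -> exists t : R, [/\ t != b, `|t - b| < e & f t = 0].

Let cF k : continuous (F k).
Proof. by move=> x; exact: is_derive1_continuous. Qed.

Lemma MVT_sym (k : nat) (b t : R) : b != t ->
  exists c : R, [/\ c != b, `|c - b| < `|t - b| &
    F k t - F k b = F k.+1 c * (t - b)].
Proof.
move=> /eqP/eqP; rewrite neq_lt => /orP[bt|tb].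
- have [c] := @MVT _ (F k) (F k.+1) b t bt (fun x _ => dF k x)
    (continuous_subspaceT (@cF k)).
  rewrite in_itv/= => /andP[bc ct] E; exists c; split=> //.
    by rewrite gt_eqF.
  by rewrite !gtr0_norm ?subr_gt0// ltrD2r.
- have [c] := @MVT _ (F k) (F k.+1) t b tb (fun x _ => dF k x)
    (continuous_subspaceT (@cF k)).
  rewrite in_itv/= => /andP[tc cb] E; exists c; split=> //.
  + by rewrite lt_eqF.
  + by rewrite !ltr0_norm ?subr_lt0// ltrN2 ltrD2r.
  + by rewrite -opprB E -mulrN opprB.
Qed.

Lemma zeros_cluster_at k b : zeros_cluster (F k) b -> F k b = 0.
Proof.
move=> za; apply/eqP/negPn/negP => Fb0.
have Fb : 0 < `|F k b| by rewrite normr_gt0.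
have /cvgrPdist_lt/(_ _ Fb) [e /= e0 he] := @cF k b.
have [t [_ te Ft]] := za _ e0.
have := he t; rewrite /= Ft subr0 ltxx distrC => H.
by have := H te.
Qed.

Lemma zeros_cluster_derive k b :
  zeros_cluster (F k) b -> zeros_cluster (F k.+1) b.
Proof.
move=> za e e0; have [t [tb te Ft]] := za _ e0.
have [|c [cb ct]] := @MVT_sym k b t; first by rewrite eq_sym.
rewrite Ft (zeros_cluster_at za) subrr => /esym/eqP.
rewrite mulf_eq0 (subr_eq0 t b) (negPf tb) orbF => /eqP Fc.
by exists c; split=> //; exact: lt_trans te.
Qed.

Variables (M c : R).
Hypothesis c0 : 0 < c.
Hypothesis FM : forall k x, `|F k x| <= M * c ^+ k.

(* On this ball each application of the mean value theorem gains a factor 1/2. *)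
Lemma vanishing_derivatives_near b t : (forall k, F k b = 0) ->
  `|t - b| <= (2 * c)^-1 -> forall k, F k t = 0.
Proof.
move=> Fb tb.
have c20 : 0 < 2 * c by rewrite mulr_gt0.
have H j : forall k s, `|s - b| <= (2 * c)^-1 -> `|F k s| <= M * c ^+ k * 2 ^- j.
  elim: j => [|j IH] k s sb; first by rewrite expr0 invr1 mulr1.
  have [->|bs] := eqVneq s b.
    rewrite Fb normr0; apply: mulr_ge0; last by rewrite invr_ge0 exprn_ge0.
    exact: le_trans (FM k b).
  have [|r [_ rs]] := @MVT_sym k b s; first by rewrite eq_sym.
  rewrite Fb subr0 => ->; rewrite normrM.
  apply: (@le_trans _ _ (M * c ^+ k.+1 * 2 ^- j * (2 * c)^-1)).
    by apply: ler_pM => //; apply: IH; exact: le_trans (ltW rs) sb.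
  rewrite le_eqVlt; apply/orP; left; apply/eqP; rewrite !exprS; field.
  by rewrite !gt_eqF// exprn_gt0.
move=> k; apply/eqP; rewrite -normr_le0 leNgt; apply/negP => Ft.
have Mck : 0 < M * c ^+ k by exact: lt_le_trans (FM k t).
have [j hj] : exists j : nat, M * c ^+ k < `|F k t| * 2 ^+ j.
  pose y := M * c ^+ k / `|F k t|.
  have y0 : 0 <= y by rewrite divr_ge0// ltW.
  exists (Num.Def.archi_bound y).
  rewrite [ltRHS]mulrC -ltr_pdivrMr//; apply: lt_trans (archi_boundP y0) _.
  by rewrite -natrX ltr_nat ltn_expl.
have := H j k t tb.
by rewrite ler_pdivlMr ?exprn_gt0// leNgt hj.
Qed.

(** All derivatives vanish throughout a ball whose radius does not depend on the centre, so each of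
    its points can serve as the next centre; finitely many steps reach [t]. *)
Lemma vanishing_derivatives b t : (forall k, F k b = 0) -> F 0%N t = 0.
Proof.
move=> Fb.
have h0 : 0 < (2 * c)^-1 by rewrite invr_gt0 mulr_gt0.
have [n hn] : exists n : nat, `|t - b| <= (2 * c)^-1 * n%:R.
  have y0 : 0 <= `|t - b| * (2 * c) by rewrite mulr_ge0// mulr_ge0// ltW.
  exists (Num.Def.archi_bound (`|t - b| * (2 * c))).
  rewrite mulrC ler_pdivlMr ?mulr_gt0//; exact: ltW (archi_boundP y0).
suff : forall n s, `|s - b| <= (2 * c)^-1 * n%:R -> forall k, F k s = 0.
  by move=> /(_ n t hn 0%N).
elim=> [s|m IH s sb].
  by rewrite mulr0 normr_le0 subr_eq0 => /eqP ->.
(* The point at fraction m / (m + 1) of the way from [b] to [s]: it is within m steps of [b], and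
   [s] is within one step of it. *)
pose r := b + (s - b) * (m%:R / m.+1%:R).
have m0 : m.+1%:R != 0 :> R by rewrite pnatr_eq0.
have m10 : 0 < m.+1%:R :> R by rewrite ltr0n.
apply: (@vanishing_derivatives_near r).
  apply: IH; rewrite /r [b + _]addrC addrK normrM.
  rewrite (@ger0_norm _ (_ / _)) ?divr_ge0// mulrA ler_pdivrMr//.
  by rewrite mulrAC ler_wpM2r.
have -> : s - r = (s - b) / m.+1%:R.
  by rewrite /r -natr1; field; rewrite natr1.
by rewrite normrM normfV (@gtr0_norm _ m.+1%:R)// ler_pdivrMr.
Qed.

Lemma vanishing_of_clustering_zeros b t :
  zeros_cluster (F 0%N) b -> F 0%N t = 0.
Proof.
move=> za; apply: (@vanishing_derivatives b).
suff H k : zeros_cluster (F k) b by move=> k; exact: zeros_cluster_at.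
by elim: k => // k; exact: zeros_cluster_derive.
Qed.

End VanishingDerivatives.

(** * Cosine and sine transforms *)

Section TrigTransforms.
Variable R : realType.
Local Notation mu := (@lebesgue_measure R).
Local Notation L1 f := (mu.-integrable setT (EFin \o f)).
Implicit Types (A B f g : R -> R).

(** For a real amplitude [A] the Fourier transform is [costr A - i sintr A] and the inverse one is
    [costr A + i sintr A], so the same two functions serve both directions. *)
Definition costr A (x : R) : R := \int[mu]_w (A w * cos (2 * pi * w * x)).
Definition sintr A (x : R) : R := \int[mu]_w (A w * sin (2 * pi * w * x)).

Lemma eq_int f g : f =1 g -> \int[mu]_x f x = \int[mu]_x g x.
Proof. by move=> fg; apply: eq_Rintegral => x _; exact: fg. Qed.

Lemma normr_cos_le1 (x : R) : `|cos x| <= 1.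
Proof. by rewrite ler_norml cos_geN1 cos_le1. Qed.

Lemma normr_sin_le1 (x : R) : `|sin x| <= 1.
Proof. by rewrite ler_norml sin_geN1 sin_le1. Qed.

Lemma measurable_cos_lin (c : R) : measurable_fun setT (fun w : R => cos (c * w)).
Proof.
apply: continuous_measurable_fun => x.
apply: (@continuous_comp _ _ _ (fun t => c * t) cos); last exact: continuous_cos.
by apply: cvgM; [exact: cvg_cst|exact: cvg_id].
Qed.

Lemma measurable_sin_lin (c : R) : measurable_fun setT (fun w : R => sin (c * w)).
Proof.
apply: continuous_measurable_fun => x.
apply: (@continuous_comp _ _ _ (fun t => c * t) sin); last exact: continuous_sin.
by apply: cvgM; [exact: cvg_cst|exact: cvg_id].
Qed.

Lemma measurable_cosw (x : R) :
  measurable_fun setT (fun w : R => cos (2 * pi * w * x)).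
Proof.
rewrite (_ : (fun _ => _) = fun w : R => cos (2 * pi * x * w)).
  exact: measurable_cos_lin.
by apply/funext => w; congr cos; ring.
Qed.

Lemma measurable_sinw (x : R) :
  measurable_fun setT (fun w : R => sin (2 * pi * w * x)).
Proof.
rewrite (_ : (fun _ => _) = fun w : R => sin (2 * pi * x * w)).
  exact: measurable_sin_lin.
by apply/funext => w; congr sin; ring.
Qed.

Lemma L1_cos A x : L1 A -> L1 (fun w => A w * cos (2 * pi * w * x)).
Proof.
move=> LA; apply: (@L1M_bounded _ _ _ 1) => //; first exact: measurable_cosw.
by move=> w; exact: normr_cos_le1.
Qed.

Lemma L1_sin A x : L1 A -> L1 (fun w => A w * sin (2 * pi * w * x)).
Proof.
move=> LA; apply: (@L1M_bounded _ _ _ 1) => //; first exact: measurable_sinw.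
by move=> w; exact: normr_sin_le1.
Qed.

Lemma normr_costr A x : L1 A -> `|costr A x| <= \int[mu]_w `|A w|.
Proof.
move=> LA; apply: normr_int_le; [exact: L1_cos|exact: L1_norm|move=> w].
by rewrite normrM ler_piMr// normr_cos_le1.
Qed.

Lemma normr_sintr A x : L1 A -> `|sintr A x| <= \int[mu]_w `|A w|.
Proof.
move=> LA; apply: normr_int_le; [exact: L1_sin|exact: L1_norm|move=> w].
by rewrite normrM ler_piMr// normr_sin_le1.
Qed.

Lemma continuous_costr A : L1 A -> continuous (costr A).
Proof.
move=> LA x.
have := @continuity_under_integral R _ _ mu
  (fun x w => A w * cos (2 * pi * w * x)) setT measurableT (x - 1) (x + 1)
  _ _ (fun w => `|A w|) (L1_norm LA) _ x.
apply.
- by move=> y _; exact: L1_cos.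
- apply: aeW => w _ y _; apply: cvgM; first exact: cvg_cst.
  apply: (@continuous_comp _ _ _ (fun t => 2 * pi * w * t) cos);
    last exact: continuous_cos.
  by apply: cvgM; [exact: cvg_cst|exact: cvg_id].
- move=> y _; apply: aeW => w _.
  by rewrite normrM ler_piMr// normr_cos_le1.
- by rewrite inE/= in_itv/=; apply/andP; split; lra.
Qed.

Lemma continuous_sintr A : L1 A -> continuous (sintr A).
Proof.
move=> LA x.
have := @continuity_under_integral R _ _ mu
  (fun x w => A w * sin (2 * pi * w * x)) setT measurableT (x - 1) (x + 1)
  _ _ (fun w => `|A w|) (L1_norm LA) _ x.
apply.
- by move=> y _; exact: L1_sin.
- apply: aeW => w _ y _; apply: cvgM; first exact: cvg_cst.
  apply: (@continuous_comp _ _ _ (fun t => 2 * pi * w * t) sin);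
    last exact: continuous_sin.
  by apply: cvgM; [exact: cvg_cst|exact: cvg_id].
- move=> y _; apply: aeW => w _.
  by rewrite normrM ler_piMr// normr_sin_le1.
- by rewrite inE/= in_itv/=; apply/andP; split; lra.
Qed.

Lemma measurable_costr A : L1 A -> measurable_fun setT (costr A).
Proof. by move=> LA; apply: continuous_measurable_fun; exact: continuous_costr. Qed.

Lemma measurable_sintr A : L1 A -> measurable_fun setT (sintr A).
Proof. by move=> LA; apply: continuous_measurable_fun; exact: continuous_sintr. Qed.

(** Fubini: a kernel bounded by 1 leaves |A(w)| |B(x)| as an integrable majorant on the plane. *)
Lemma kernel_pairing (K : R -> R -> R) A B :
  measurable_fun [set: measurableTypeR R * measurableTypeR R]
    (fun z => K z.1 z.2) ->
  (forall w x, `|K w x| <= 1) -> L1 A -> L1 B ->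
  \int[mu]_x ((\int[mu]_w (A w * K w x)) * B x) =
  \int[mu]_w (A w * \int[mu]_x (B x * K w x)).
Proof.
move=> mK K1 LA LB.
have mA := L1_measurable LA; have mB := L1_measurable LB.
have LAK x : L1 (fun w => A w * K w x).
  apply: (@L1M_bounded _ _ _ 1) => //.
  by apply: (@measurableT_comp _ _ _ _ _ _ (fun z => K z.1 z.2) _ (fun w => (w, x)));
    last exact: measurable_pair2.
have LBK w : L1 (fun x => B x * K w x).
  apply: (@L1M_bounded _ _ _ 1) => //.
  by apply: (@measurableT_comp _ _ _ _ _ _ (fun z => K z.1 z.2) _ (fun x => (w, x)));
    last exact: measurable_pair1.
pose F (z : measurableTypeR R * measurableTypeR R) : \bar R :=
  (A z.1 * (B z.2 * K z.1 z.2))%:E.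
have mF : measurable_fun setT F.
  apply/measurable_EFinP; apply: measurable_funM.
    exact: measurableT_comp.
  by apply: measurable_funM => //; exact: measurableT_comp.
have iF : ((mu \x mu)%E).-integrable setT F.
  apply/(integrable12ltyP _ _ mF).
  apply: (@le_lt_trans _ _ (\int[mu]_w (`|A w| * \int[mu]_x `|B x|)%:E)%E).
    apply: ge0_le_integral => //.
    - by move=> w _; apply: integral_ge0.
    - apply: (measurable_fun_fubini_tonelli_F (abse \o F)).
      + exact: measurableT_comp.
      + by move=> z; exact: abse_ge0.
    - apply/measurable_EFinP; apply: measurable_funM => //.
      exact: measurableT_comp.
    - move=> w _; rewrite EFinM EFin_int; last exact: L1_norm.
      rewrite -ge0_integralZl_EFin//; last first.
        apply/measurable_EFinP; exact: measurableT_comp.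
      apply: ge0_le_integral => //.
      + apply: (@measurableT_comp _ _ _ _ _ _ abse _ (fun x => F (w, x))) => //.
        exact: (measurableT_comp mF (measurable_pair1 w)).
      + by apply/measurable_EFinP; apply: measurable_funM => //;
          exact: measurableT_comp.
      + move=> x _; rewrite /F/= lee_fin !normrM ler_wpM2l// ler_piMr//.
  rewrite -EFin_int ?ltry//.
  have := L1Z (\int[mu]_x `|B x|) (L1_norm LA).
  by congr (mu.-integrable _ _); apply/funext => w /=; rewrite mulrC.
have := @Fubini _ _ _ _ R mu mu F iF.
have -> : (fun w => \int[mu]_x F (w, x))%E =
    (fun w => (A w * \int[mu]_x (B x * K w x))%:E).
  apply/funext => w; rewrite -RintegralZl// (EFin_int (L1Z (A w) (LBK w))).
  exact: eq_integral.
have -> : (fun x => \int[mu]_w F (w, x))%E =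
    (fun x => ((\int[mu]_w (A w * K w x)) * B x)%:E).
  apply/funext => x; rewrite mulrC -RintegralZl// (EFin_int (L1Z (B x) (LAK x))).
  by apply: eq_integral => w _; rewrite /F/= mulrCA.
by move=> H; rewrite /Rintegral H.
Qed.

Let measurable_phase : measurable_fun [set: measurableTypeR R * measurableTypeR R]
  (fun z => 2 * pi * z.1 * z.2 : R).
Proof.
by apply: measurable_funM => //; apply: measurable_funM.
Qed.

(** The kernel cos(2 pi w x) is symmetric in w and x, so the transform is its own transpose;
    likewise for the sine. *)
Lemma costr_pairing A B : L1 A -> L1 B ->
  \int[mu]_x (costr A x * B x) = \int[mu]_w (A w * costr B w).
Proof.
move=> LA LB; rewrite /costr (kernel_pairing (K := fun w x => cos (2 * pi * w * x)))//.
- by apply: eq_int => w; congr (_ * _); apply: eq_int => x;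
    rewrite (mulrAC _ w x).
- apply: (measurableT_comp _ measurable_phase).
  exact: (continuous_measurable_fun (@continuous_cos R)).
- by move=> w x; exact: normr_cos_le1.
Qed.

Lemma sintr_pairing A B : L1 A -> L1 B ->
  \int[mu]_x (sintr A x * B x) = \int[mu]_w (A w * sintr B w).
Proof.
move=> LA LB; rewrite /sintr (kernel_pairing (K := fun w x => sin (2 * pi * w * x)))//.
- by apply: eq_int => w; congr (_ * _); apply: eq_int => x;
    rewrite (mulrAC _ w x).
- apply: (measurableT_comp _ measurable_phase).
  exact: (continuous_measurable_fun (@continuous_sin R)).
- by move=> w x; exact: normr_sin_le1.
Qed.

Lemma L1_costrM A B : L1 A -> L1 B -> L1 (fun x => costr A x * B x).
Proof.
move=> LA LB; have := L1M_bounded LB (measurable_costr LA) (fun x => normr_costr x LA).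
by congr (mu.-integrable _ _); apply/funext => x /=; rewrite mulrC.
Qed.

Lemma L1_sintrM A B : L1 A -> L1 B -> L1 (fun x => sintr A x * B x).
Proof.
move=> LA LB; have := L1M_bounded LB (measurable_sintr LA) (fun x => normr_sintr x LA).
by congr (mu.-integrable _ _); apply/funext => x /=; rewrite mulrC.
Qed.

End TrigTransforms.

(** * The multiplication formula for the Fourier transform on L2 *)

Section FourierL2.
Variable R : realType.
Local Notation mu := (@lebesgue_measure R).
Local Notation L1 f := (mu.-integrable setT (EFin \o f)).
Implicit Types (f g u : R -> R[i]) (A B : R -> R).

Local Notation Lsq A := (measurable_fun setT A /\ L1 (fun x => A x ^+ 2)).

Lemma Lfun2_Lsq A : A \in Lfun mu 2%:E -> Lsq A.
Proof.
move=> lA; split; last exact: Lfun2_integrable_sqr.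
by move: lA; rewrite inE => /andP[/[!inE]].
Qed.

Lemma cRe_fourier u w : L1 (cRe u) -> L1 (cIm u) ->
  cRe (fourier u) w = costr (cRe u) w + sintr (cIm u) w.
Proof.
move=> L1u L2u; rewrite /fourier /cintegral /costr /sintr {1}/cRe /=.
rewrite -RintegralD//; [|exact: L1_cos|exact: L1_sin].
apply: eq_Rintegral => x _; rewrite /cRe /cIm /expi.
case: (u x) => p q /=; rewrite cosN sinN.
by rewrite (mulrAC _ w x); ring.
Qed.

Lemma cIm_fourier u w : L1 (cRe u) -> L1 (cIm u) ->
  cIm (fourier u) w = costr (cIm u) w - sintr (cRe u) w.
Proof.
move=> L1u L2u; rewrite /fourier /cintegral /costr /sintr {1}/cIm /=.
rewrite -RintegralB//; [|exact: L1_cos|exact: L1_sin].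
apply: eq_Rintegral => x _; rewrite /cRe /cIm /expi.
case: (u x) => p q /=; rewrite cosN sinN.
by rewrite (mulrAC _ w x); ring.
Qed.

Lemma L2dist_components f g (s : R) : 0 <= s ->
  measurable_fun setT (cRe f) -> measurable_fun setT (cIm f) ->
  measurable_fun setT (cRe g) -> measurable_fun setT (cIm g) ->
  (L2dist f g <= s%:E)%E ->
  [/\ L1 (fun x => (cRe f x - cRe g x) ^+ 2),
      L1 (fun x => (cIm f x - cIm g x) ^+ 2),
      \int[mu]_x ((cRe f x - cRe g x) ^+ 2) <= s ^+ 2 &
      \int[mu]_x ((cIm f x - cIm g x) ^+ 2) <= s ^+ 2].
Proof.
move=> s0 mf1 mf2 mg1 mg2 fgs.
pose q x := (cRe f x - cRe g x) ^+ 2 + (cIm f x - cIm g x) ^+ 2.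
have mq1 : measurable_fun setT (fun x => (cRe f x - cRe g x) ^+ 2).
  by apply: measurable_funX; exact: measurable_funB.
have mq2 : measurable_fun setT (fun x => (cIm f x - cIm g x) ^+ 2).
  by apply: measurable_funX; exact: measurable_funB.
have mq : measurable_fun setT q by exact: measurable_funD.
have q0 x : 0 <= q x by apply: addr_ge0; exact: sqr_ge0.
have qs : (\int[mu]_x (q x)%:E <= (s ^+ 2)%:E)%E.
  have <- : (\int[mu]_x (`|(Normc.normc (f x - g x))%:E| `^ 2) =
      \int[mu]_x (q x)%:E)%E.
    apply: eq_integral => x _.
    rewrite /q /cRe /cIm; case: (f x) => a b; case: (g x) => c d /=.
    rewrite ger0_norm ?sqrtr_ge0// powR_mulrn ?sqrtr_ge0// sqr_sqrtr//.
    by apply: addr_ge0; exact: sqr_ge0.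
  rewrite -powR_Lnorm// -(powR_mulrn 2 s0) -poweR_EFin.
  by apply: gt0_ler_poweR; rewrite ?in_itv/= ?Lnorm_ge0 ?leey ?lee_fin ?s0.
have Lq : L1 q by apply: ge0_L1 => //; exact: le_lt_trans qs (ltry _).
have L1q : L1 (fun x => (cRe f x - cRe g x) ^+ 2).
  apply: L1_le Lq => // x; rewrite ger0_norm ?sqr_ge0// lerDl; exact: sqr_ge0.
have L2q : L1 (fun x => (cIm f x - cIm g x) ^+ 2).
  apply: L1_le Lq => // x; rewrite ger0_norm ?sqr_ge0// lerDr; exact: sqr_ge0.
have Iq : \int[mu]_x q x <= s ^+ 2 by rewrite -lee_fin EFin_int.
split=> //; apply: le_trans Iq; apply: le_int => // x.
- by rewrite lerDl; exact: sqr_ge0.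
- by rewrite lerDr; exact: sqr_ge0.
Qed.

Lemma L2dist_near (u : nat -> R -> R[i]) f (s : R) : 0 < s ->
  L2dist (u n) f @[n --> \oo] --> 0%E ->
  \forall n \near \oo, (L2dist (u n) f <= s%:E)%E.
Proof.
move=> s0 /fine_cvgP[fin /cvgrPdist_lt/(_ _ s0) H]; near=> n.
have h1 : L2dist (u n) f \is a fin_num by near: n.
rewrite -(fineK h1) lee_fin; apply: ltW; apply: le_lt_trans (ler_norm _) _.
by rewrite -normrN -sub0r; near: n.
Unshelve. all: by end_near. Qed.

Let tri_add (a p q p' q' x y z : R) :
  `|(p + q) - a| <= x -> `|p - p'| <= y -> `|q - q'| <= z ->
  `|a - (p' + q')| <= x + y + z.
Proof.
rewrite !ler_norml => /andP[? ?] /andP[? ?] /andP[? ?].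
by apply/andP; split; lra.
Qed.

Let tri_sub (a p q p' q' x y z : R) :
  `|(p - q) - a| <= x -> `|p - p'| <= y -> `|q - q'| <= z ->
  `|a - (p' - q')| <= x + y + z.
Proof.
rewrite !ler_norml => /andP[? ?] /andP[? ?] /andP[? ?].
by apply/andP; split; lra.
Qed.

(** These are the real and imaginary parts of int g A = int f (costr A - i sintr A). The
    approximating sequence is used here and nowhere else: for its terms the identity is Fubini, and
    square integrability of [A] and of its two transforms lets both sides pass to the L2 limit
    through [small_pairing]. *)
Lemma fourierL2_pairing f g A : is_fourierL2 f g ->
  L1 A -> Lsq A -> Lsq (costr A) -> Lsq (sintr A) ->
  \int[mu]_w (cRe g w * A w) =
    \int[mu]_x (cRe f x * costr A x) + \int[mu]_x (cIm f x * sintr A x) /\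
  \int[mu]_w (cIm g w * A w) =
    \int[mu]_x (cIm f x * costr A x) - \int[mu]_x (cRe f x * sintr A x).
Proof.
move=> [] [/Lfun2_Lsq[mf1 Lf1] /Lfun2_Lsq[mf2 Lf2]].
move=> [/Lfun2_Lsq[mg1 Lg1] /Lfun2_Lsq[mg2 Lg2]] [u [Lu uf ug]].
move=> LA [mA LA2] [mC LC] [mS LS].
pose M := (1 + \int[mu]_w (A w ^+ 2)) + (1 + \int[mu]_x (costr A x ^+ 2)) +
  (1 + \int[mu]_x (sintr A x ^+ 2)).
have pos B : 0 < 1 + \int[mu]_w (B w ^+ 2).
  by apply: ltr_pwDl => //; apply: int_ge0 => w; exact: sqr_ge0.
have M0 : 0 < M := addr_gt0 (addr_gt0 (pos _) (pos _)) (pos _).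
have key (s : R) : 0 < s ->
  `|\int[mu]_w (cRe g w * A w) - (\int[mu]_x (cRe f x * costr A x) +
      \int[mu]_x (cIm f x * sintr A x))| <= s * M /\
  `|\int[mu]_w (cIm g w * A w) - (\int[mu]_x (cIm f x * costr A x) -
      \int[mu]_x (cRe f x * sintr A x))| <= s * M.
  move=> s0.
  have [n [nf ng]] : exists n, (L2dist (u n) f <= s%:E)%E /\
      (L2dist (fourier (u n)) g <= s%:E)%E.
    near \oo => n; exists n; split; near: n; exact: L2dist_near.
  have [[/Lfun1_integrable L1u /Lfun1_integrable L2u] [/Lfun2_Lsq[mu1 Lu1]
    /Lfun2_Lsq[mu2 Lu2]]] := Lu n.
  have E1 : cRe (fourier (u n)) = fun w => costr (cRe (u n)) w + sintr (cIm (u n)) w.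
    by apply/funext => w; exact: cRe_fourier.
  have E2 : cIm (fourier (u n)) = fun w => costr (cIm (u n)) w - sintr (cRe (u n)) w.
    by apply/funext => w; exact: cIm_fourier.
  have mF1 : measurable_fun setT (cRe (fourier (u n))).
    by rewrite E1; apply: measurable_funD; [exact: measurable_costr|exact: measurable_sintr].
  have mF2 : measurable_fun setT (cIm (fourier (u n))).
    by rewrite E2; apply: measurable_funB; [exact: measurable_costr|exact: measurable_sintr].
  have [a1 a2 b1 b2] := L2dist_components (ltW s0) mu1 mu2 mf1 mf2 nf.
  have [c1 c2 d1 d2] := L2dist_components (ltW s0) mF1 mF2 mg1 mg2 ng.
  have p1 : \int[mu]_w (cRe (fourier (u n)) w * A w) =
      \int[mu]_x (cRe (u n) x * costr A x) + \int[mu]_x (cIm (u n) x * sintr A x).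
    rewrite -costr_pairing// -sintr_pairing// -RintegralD//;
      [|exact: L1_costrM|exact: L1_sintrM].
    by apply: eq_int => w; rewrite E1 mulrDl.
  have p2 : \int[mu]_w (cIm (fourier (u n)) w * A w) =
      \int[mu]_x (cIm (u n) x * costr A x) - \int[mu]_x (cRe (u n) x * sintr A x).
    rewrite -costr_pairing// -sintr_pairing// -RintegralB//;
      [|exact: L1_costrM|exact: L1_sintrM].
    by apply: eq_int => w; rewrite E2 mulrBl.
  have diff (P Q B : R -> R) : measurable_fun setT P -> measurable_fun setT Q ->
      measurable_fun setT B -> L1 (fun x => (P x - Q x) ^+ 2) ->
      L1 (fun x => Q x ^+ 2) -> L1 (fun x => B x ^+ 2) ->
      \int[mu]_x ((P x - Q x) ^+ 2) <= s ^+ 2 ->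
      `|\int[mu]_x (P x * B x) - \int[mu]_x (Q x * B x)| <=
        s * (1 + \int[mu]_x (B x ^+ 2)).
    move=> mP mQ mB LPQ LQ LB PQs.
    have mPQ : measurable_fun setT (fun x => P x - Q x) by exact: measurable_funB.
    have LQB : L1 (fun x => Q x * B x) by exact: sqr_L1M.
    have LPQB : L1 (fun x => (P x - Q x) * B x) by exact: sqr_L1M.
    have -> : \int[mu]_x (P x * B x) =
        \int[mu]_x ((P x - Q x) * B x) + \int[mu]_x (Q x * B x).
      by rewrite -RintegralD//; apply: eq_int => x; ring.
    by rewrite addrK; exact: small_pairing.
  have q1 := diff _ _ _ mF1 mg1 mA c1 Lg1 LA2 d1.
  have q2 := diff _ _ _ mF2 mg2 mA c2 Lg2 LA2 d2.
  have q3 := diff _ _ _ mu1 mf1 mC a1 Lf1 LC b1.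
  have q4 := diff _ _ _ mu2 mf2 mC a2 Lf2 LC b2.
  have q5 := diff _ _ _ mu1 mf1 mS a1 Lf1 LS b1.
  have q6 := diff _ _ _ mu2 mf2 mS a2 Lf2 LS b2.
  rewrite p1 in q1; rewrite p2 in q2.
  rewrite /M !mulrDr; split.
    by rewrite !mulrDr in q1 q3 q6; exact: tri_add q1 q3 q6.
  by rewrite !mulrDr in q2 q4 q5; exact: tri_sub q2 q4 q5.
have small_eq (x y : R) : (forall s, 0 < s -> `|x - y| <= s * M) -> x = y.
  move=> h; apply/eqP; rewrite -subr_eq0 -normr_le0 leNgt; apply/negP => xy.
  have := h (`|x - y| / (2 * M)).
  rewrite divr_gt0// ?mulr_gt0// => /(_ isT).
  rewrite invfM mulrA mulfVK ?gt_eqF// ler_pdivlMr// ger_pMr// leNgt ltr1n//.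
by split; apply: small_eq => s /key[].
Unshelve. all: by end_near. Qed.

End FourierL2.

(** * The Poisson kernel *)

Section Poisson.
Variable R : realType.
Local Notation mu := (@lebesgue_measure R).
Local Notation L1 f := (mu.-integrable setT (EFin \o f)).
Implicit Types (f : R -> R) (e x y t w : R).

Definition two_sided_exp e w : R := expR (- (e * `|w|)).

(** The Poisson kernel of the upper half-plane at height e / (2 pi), normalised to mass 1. *)
Definition poisson e y : R := 2 * e / (e ^+ 2 + (2 * pi * y) ^+ 2).

Lemma ge0_integral_reflect (f : R -> \bar R) : measurable_fun setT f ->
  (forall x, 0 <= f x)%E -> (\int[mu]_x f (- x)%R = \int[mu]_x f x)%E.
Proof.
move=> mf f0.
have mN : measurable_fun [set: R] (-%R : R -> R).
  by apply: continuous_measurable_fun => x; apply: cvgN; exact: cvg_id.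
have mfN : measurable_fun setT (fun x => f (- x)) by exact: measurableT_comp mf mN.
have split_ (g : R -> \bar R) : measurable_fun setT g -> (forall x, 0 <= g x)%E ->
    (\int[mu]_x g x = \int[mu]_(x in `]-oo, 0%R]) g x +
                      \int[mu]_(x in `[0%R, +oo[) g x)%E.
  move=> mg g0; rewrite -(setUv `[0%R, +oo[%classic) ge0_integral_setU//=.
  - rewrite addeC setCitvr integral_itv_bndo_bndc//.
    exact: measurable_funTS.
  - exact: measurableC.
  - by rewrite setUv.
  - exact/disj_setPCl.
rewrite !split_// -(ge0_integration_by_substitution0 mf f0).
rewrite (ge0_integration_by_substitution0 mfN (fun x => f0 _)) addeC.
by congr (_ + _)%E; apply: eq_integral => x _; rewrite opprK.
Qed.

Lemma two_sided_exp_gt0 e w : 0 < two_sided_exp e w.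
Proof. exact: expR_gt0. Qed.

Lemma two_sided_exp_le1 e w : 0 <= e -> two_sided_exp e w <= 1.
Proof. by move=> e0; rewrite /two_sided_exp -expR0 ler_expR oppr_le0 mulr_ge0. Qed.

Lemma normr_two_sided_exp_le1 e w : 0 <= e -> `|two_sided_exp e w| <= 1.
Proof. by move=> e0; rewrite ger0_norm ?two_sided_exp_le1// expR_ge0. Qed.

Lemma continuous_two_sided_exp e : continuous (two_sided_exp e).
Proof.
move=> w; apply: (@continuous_comp _ _ _ (fun t => - (e * `|t|)) expR);
  last exact: continuous_expR.
apply: cvgN; apply: cvgM; first exact: cvg_cst.
by apply: cvg_norm; exact: cvg_id.
Qed.

Lemma measurable_two_sided_exp e : measurable_fun setT (two_sided_exp e).
Proof. exact: (continuous_measurable_fun (@continuous_two_sided_exp e)). Qed.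

Lemma cvg_expRNM (e : R) : 0 < e -> expR (- (e * w)) @[w --> +oo] --> (0 : R).
Proof.
move=> e0.
apply: (@cvg_comp _ _ _ (fun w => e * w) (fun t : R => expR (- t)) _ (pinfty_nbhs R));
  last exact: cvgr_expR.
exact: gt0_cvgMry.
Qed.

(** The summand 1 makes the integrand nonnegative, so that the improper integral can be read off an
    antiderivative. The case b = 0 gives the integral of the exponential alone, and subtracting it
    isolates the cosine transform. *)
Lemma integral_two_sided_exp_cos e b : 0 < e ->
  (\int[mu]_w (two_sided_exp e w * (1 + cos (b * w)))%:E =
   (2 * (e^-1 + e / (e ^+ 2 + b ^+ 2)))%:E)%E.
Proof.
move=> e0.
have D0 : 0 < e ^+ 2 + b ^+ 2 by rewrite ltr_pwDl ?exprn_gt0// sqr_ge0.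
pose h w := two_sided_exp e w * (1 + cos (b * w)).
(* An antiderivative of [h] on the half-line w >= 0, vanishing at infinity. The terms [+ 0] fit the
   affine form of [is_derive1_comp_affine]. *)
pose F w := expR (- e * w + 0) *
  (- e^-1 + (e ^+ 2 + b ^+ 2)^-1 * (b * sin (b * w + 0) - e * cos (b * w + 0))).
pose F' w := expR (- e * w + 0) * (1 + cos (b * w + 0)).
have dF w : is_derive w 1 F (F' w).
  have dE := is_derive1_comp_affine (is_derive_expR (- e * w + 0)).
  have dS := is_derive1_comp_affine (is_derive_sin (b * w + 0)).
  have dC := is_derive1_comp_affine (is_derive_cos (b * w + 0)).
  have := is_derive1M dE (is_derive1D (is_derive_cst (- e^-1) w 1)
    (is_derive1Z (e ^+ 2 + b ^+ 2)^-1
      (is_derive1B (is_derive1Z b dS) (is_derive1Z e dC)))).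
  move=> H; apply: (is_derive_eq H); rewrite /F'/=; field.
  by rewrite !lt0r_neq0.
have hF' w : 0 <= w -> h w = F' w.
  by move=> w0; rewrite /h /F' /two_sided_exp ger0_norm// !addr0 mulNr.
have h0 w : 0 <= h w.
  apply: mulr_ge0; first exact/ltW/two_sided_exp_gt0.
  by have := cos_geN1 (b * w); lra.
have ch : continuous h.
  apply: continuous_fM; first exact: continuous_two_sided_exp.
  apply: continuous_fD; first by move=> x; exact: cvg_cst.
  move=> w; apply: (@continuous_comp _ _ _ (fun t => b * t) cos);
    last exact: continuous_cos.
  by apply: cvgM; [exact: cvg_cst|exact: cvg_id].
rewrite (ge0_symfun_integralT h0 ch); last first.
  by move=> w; rewrite /h /two_sided_exp /= normrN mulrN cosN.
rewrite -set_itvcy (@ge0_continuous_FTC2y _ h F 0 0)//.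
- rewrite -EFinB -EFinM; congr EFin; rewrite /F !mulr0 addr0 expR0 sin0 cos0.
  by ring.
- exact: continuous_subspaceT.
- apply: (@squeeze_cvgr _ _ _ _ (fun w => - (expR (- (e * w)) *
      (e^-1 + (`|b| + e) / (e ^+ 2 + b ^+ 2))))
    (fun w => expR (- (e * w)) * (e^-1 + (`|b| + e) / (e ^+ 2 + b ^+ 2)))).
  + apply: nearW => w; rewrite -ler_norml /F normrM !addr0 mulNr.
    rewrite (ger0_norm (expR_ge0 _)) ler_wpM2l ?expR_ge0//.
    rewrite (le_trans (ler_normD _ _))// normrN (@gtr0_norm _ e^-1) ?invr_gt0//.
    rewrite lerD2l normrM (gtr0_norm (_ : 0 < (e ^+ 2 + b ^+ 2)^-1)) ?invr_gt0//.
    rewrite [leLHS]mulrC ler_wpM2r ?invr_ge0 ?(ltW D0)//.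
    rewrite (le_trans (ler_normB _ _))// !normrM (gtr0_norm e0) lerD//.
      by rewrite ler_piMr// normr_sin_le1.
    by rewrite ler_piMr ?(ltW e0)// normr_cos_le1.
  + rewrite -[X in _ --> X]oppr0; apply: cvgN.
    rewrite -[X in _ --> X](mul0r (e^-1 + (`|b| + e) / (e ^+ 2 + b ^+ 2))).
    by apply: cvgM; [exact: cvg_expRNM|exact: cvg_cst].
  + rewrite -[X in _ --> X](mul0r (e^-1 + (`|b| + e) / (e ^+ 2 + b ^+ 2))).
    by apply: cvgM; [exact: cvg_expRNM|exact: cvg_cst].
- by apply: cvg_at_right_filter; exact: is_derive1_continuous.
- move=> x; rewrite in_itv/= andbT => x0.
  by rewrite derive1E (hF' _ (ltW x0)); have [] := dF x.
Qed.

End Poisson.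

(** * Transforms of damped cosines and sines; mass of the Poisson kernel *)

Section PoissonKernel.
Variable R : realType.
Local Notation mu := (@lebesgue_measure R).
Local Notation L1 f := (mu.-integrable setT (EFin \o f)).
Implicit Types (f : R -> R) (e x y t w : R).

Lemma L1_two_sided_exp e : 0 < e -> L1 (two_sided_exp e).
Proof.
move=> e0; have := integral_two_sided_exp_cos 0 e0 => H.
have L2e : L1 (fun w => two_sided_exp e w * (1 + cos (0 * w))).
  apply: ge0_L1; last by rewrite H ltry.
  - apply: measurable_funM; first exact: measurable_two_sided_exp.
    by apply: measurable_funD => //; exact: measurable_cos_lin.
  - move=> w; apply: mulr_ge0; first exact: expR_ge0.
    by have := cos_geN1 (0 * w); lra.
apply: L1_le L2e; first exact: measurable_two_sided_exp.
move=> w; have := ltW (two_sided_exp_gt0 e w); rewrite mul0r cos0 => h.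
by rewrite ger0_norm//; lra.
Qed.

Lemma int_two_sided_exp e : 0 < e -> \int[mu]_w two_sided_exp e w = 2 / e.
Proof.
move=> e0; have := integral_two_sided_exp_cos 0 e0.
have -> : (fun w => (two_sided_exp e w * (1 + cos (0 * w)))%:E) =
    (fun w => (2 * two_sided_exp e w)%:E).
  by apply/funext => w; rewrite mul0r cos0; congr EFin; ring.
rewrite -EFin_int; last exact/L1Z/L1_two_sided_exp.
rewrite RintegralZl//; last exact: L1_two_sided_exp.
set I := Rintegral _ _ _; case=> E.
suff : 2 * I = 2 * (2 / e) by apply: mulfI.
by rewrite E; field; rewrite lt0r_neq0.
Qed.

Lemma costr_two_sided_exp e x : 0 < e -> costr (two_sided_exp e) x = poisson e x.
Proof.
move=> e0; have Le := L1_two_sided_exp e0.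
have := integral_two_sided_exp_cos (2 * pi * x) e0.
have -> : (fun w => (two_sided_exp e w * (1 + cos (2 * pi * x * w)))%:E) =
    (fun w => (two_sided_exp e w + two_sided_exp e w * cos (2 * pi * w * x))%:E).
  by apply/funext => w; rewrite (mulrAC _ x w) mulrDr mulr1.
rewrite -EFin_int; last exact/L1D/L1_cos.
rewrite RintegralD//; last exact: L1_cos.
rewrite int_two_sided_exp// -/(costr _ _); case=> /(canRL (addKr _)) ->; rewrite /poisson.
have D0 : 0 < e ^+ 2 + (2 * pi * x) ^+ 2.
  by rewrite ltr_pwDl ?exprn_gt0// sqr_ge0.
move: (2 * pi * x) D0 => b D0; field; by rewrite !lt0r_neq0.
Qed.

(** The integrand is odd. The reflection formula is for nonnegative functions, hence it is applied
    to exp(- e |w|) (1 + sin), which reflects to exp(- e |w|) (1 - sin); equal integrals force the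
    sine term to vanish. *)
Lemma sintr_two_sided_exp e x : 0 < e -> sintr (two_sided_exp e) x = 0.
Proof.
move=> e0; have Le := L1_two_sided_exp e0.
pose h (s : R) w := two_sided_exp e w + s * (two_sided_exp e w * sin (2 * pi * w * x)).
have Lh s : L1 (h s) by apply: L1D => //; apply: L1Z; exact: L1_sin.
have Ih s : \int[mu]_w h s w = 2 / e + s * sintr (two_sided_exp e) x.
  rewrite RintegralD//; last by apply: L1Z; exact: L1_sin.
  by rewrite RintegralZl ?int_two_sided_exp//; exact: L1_sin.
have h0 w : (0 <= (h 1 w)%:E)%E.
  rewrite lee_fin /h mul1r -{1}[two_sided_exp e w]mulr1 -mulrDr.
  apply: mulr_ge0; first exact: expR_ge0.
  by have := sin_geN1 (2 * pi * w * x); lra.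
have : \int[mu]_w h (-1) w = \int[mu]_w h 1 w.
  apply: EFin_inj; rewrite !EFin_int//.
  rewrite -(ge0_integral_reflect _ h0); last first.
    by apply/measurable_EFinP; exact: L1_measurable.
  apply: eq_integral => w _; congr EFin.
  by rewrite /h /two_sided_exp normrN mulrN !mulNr sinN; ring.
by rewrite !Ih => /addrI; lra.
Qed.

(** Here and in the next three lemmas the product-to-sum formulas reduce the transform to that of
    the bare exponential at x - t and x + t. *)
Lemma costr_exp_cos e t x : 0 < e ->
  costr (fun w => two_sided_exp e w * cos (2 * pi * w * t)) x =
  2^-1 * (poisson e (x - t) + poisson e (x + t)).
Proof.
move=> e0; have Le := L1_two_sided_exp e0.
rewrite -!costr_two_sided_exp// /costr -RintegralD//; [|exact: L1_cos..].
rewrite -RintegralZl//; last by apply: L1D; exact: L1_cos.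
apply: eq_int => w; rewrite (mulrBr (2 * pi * w)) (mulrDr (2 * pi * w)) cosB cosD.
by field.
Qed.

Lemma sintr_exp_cos e t x : 0 < e ->
  sintr (fun w => two_sided_exp e w * cos (2 * pi * w * t)) x = 0.
Proof.
move=> e0; have Le := L1_two_sided_exp e0.
transitivity (2^-1 * (sintr (two_sided_exp e) (x - t) +
    sintr (two_sided_exp e) (x + t))).
  rewrite /sintr -RintegralD//; [|exact: L1_sin..].
  rewrite -RintegralZl//; last by apply: L1D; exact: L1_sin.
  apply: eq_int => w; rewrite (mulrBr (2 * pi * w)) (mulrDr (2 * pi * w)) sinB sinD.
  by field.
by rewrite !sintr_two_sided_exp// addr0 mulr0.
Qed.

Lemma sintr_exp_sin e t x : 0 < e ->
  sintr (fun w => two_sided_exp e w * sin (2 * pi * w * t)) x =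
  2^-1 * (poisson e (x - t) - poisson e (x + t)).
Proof.
move=> e0; have Le := L1_two_sided_exp e0.
rewrite -!costr_two_sided_exp// /costr /sintr -RintegralB//; [|exact: L1_cos..].
rewrite -RintegralZl//; last by apply: L1B; exact: L1_cos.
apply: eq_int => w; rewrite (mulrBr (2 * pi * w)) (mulrDr (2 * pi * w)) cosB cosD.
by field.
Qed.

Lemma costr_exp_sin e t x : 0 < e ->
  costr (fun w => two_sided_exp e w * sin (2 * pi * w * t)) x = 0.
Proof.
move=> e0; have Le := L1_two_sided_exp e0.
transitivity (2^-1 * (sintr (two_sided_exp e) (x + t) -
    sintr (two_sided_exp e) (x - t))).
  rewrite /sintr /costr -RintegralB//; [|exact: L1_sin..].
  rewrite -RintegralZl//; last by apply: L1B; exact: L1_sin.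
  apply: eq_int => w; rewrite (mulrBr (2 * pi * w)) (mulrDr (2 * pi * w)) sinB sinD.
  by field.
by rewrite !sintr_two_sided_exp// subrr mulr0.
Qed.

Lemma poisson_den_gt0 e y : 0 < e -> 0 < e ^+ 2 + (2 * pi * y) ^+ 2.
Proof. by move=> e0; rewrite ltr_pwDl ?exprn_gt0// sqr_ge0. Qed.

Lemma poisson_ge0 e y : 0 < e -> 0 <= poisson e y.
Proof.
by move=> e0; rewrite divr_ge0 ?(ltW (poisson_den_gt0 _ _))// mulr_ge0// ltW.
Qed.

Lemma poisson_le e y : 0 < e -> poisson e y <= 2 / e.
Proof.
move=> e0; rewrite ler_pdivrMr ?poisson_den_gt0//.
have -> : 2 * e = 2 / e * e ^+ 2 by field; rewrite lt0r_neq0.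
by rewrite ler_wpM2l ?divr_ge0 ?(ltW e0)// lerDl sqr_ge0.
Qed.

Lemma poissonN e y : poisson e (- y) = poisson e y.
Proof. by rewrite /poisson mulrN sqrrN. Qed.

Lemma continuous_poisson e : 0 < e -> continuous (poisson e).
Proof.
move=> e0 y; apply: cvgM; first exact: cvg_cst.
apply: cvgV; first by rewrite gt_eqF// poisson_den_gt0.
apply: cvgD; first exact: cvg_cst.
by apply: cvgM; apply: cvgM; [exact: cvg_cst|exact: cvg_id|exact: cvg_cst|exact: cvg_id].
Qed.

Lemma integral_inv_oneDsqr :
  (\int[mu]_y ((1 + y ^+ 2)^-1)%:E = (pi : R)%:E)%E.
Proof.
rewrite (@ge0_symfun_integralT _ (fun y => (1 + y ^+ 2)^-1)).
- rewrite -set_itvcy; have := @integral0y_oneDsqr R; rewrite /oneDsqr => ->.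
  by rewrite -EFinM; congr EFin; field.
- by move=> y; rewrite invr_ge0 addr_ge0// sqr_ge0.
- exact: continuous_oneDsqrV.
- by move=> y /=; rewrite sqrrN.
Qed.

Lemma integral_poisson_shift e t : 0 < e ->
  (\int[mu]_x (poisson e (x - t))%:E = 1)%E.
Proof.
(* The scale that turns the kernel into the Cauchy density 1 / (pi (1 + y^2)). *)
move=> e0; pose c : R := 2 * pi / e.
have c0 : 0 < c by rewrite divr_gt0// mulr_gt0// pi_gt0.
pose F : R -> R := fun x => (x + - t) * c.
pose G : R -> R := fun y => pi^-1 * (1 + y ^+ 2)^-1.
have dF x : is_derive x 1 F c.
  have := is_derive1_affine c (- (c * t)) x.
  by congr (is_derive _ _ _ _); apply/funext => y; rewrite /F; ring.
have F'E : (F^`())%classic = cst c.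
  by apply/funext => x; rewrite derive1E; have [] := dF x.
have oneD0 (y : R) : 0 < 1 + y ^+ 2 by rewrite ltr_pwDl// sqr_ge0.
have E x : poisson e (x - t) = ((G \o F) * (F^`())%classic) x.
  rewrite !fctE F'E /G /F /= /poisson /c.
  have h1 := poisson_den_gt0 (x - t) e0.
  have h2 := oneD0 ((x - t) * c).
  have pi0 : pi != 0 :> R by rewrite lt0r_neq0// pi_gt0.
  have -> : 1 + ((x - t) * (2 * pi / e)) ^+ 2 = (e ^+ 2 + (2 * pi * (x - t)) ^+ 2) / e ^+ 2.
    by field; rewrite lt0r_neq0.
  move: (e ^+ 2 + _) h1 => D h1; move: (pi : R) pi0 => p p0.
  by field; rewrite p0 !lt0r_neq0.
under eq_integral do rewrite E.
rewrite -(@increasing_ge0_integration_by_substitutionT _ F G)//.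
- rewrite /G; under eq_integral do rewrite EFinM.
  rewrite ge0_integralZl_EFin//.
  + rewrite integral_inv_oneDsqr -EFinM mulVf// lt0r_neq0// pi_gt0//.
  + by move=> y _; rewrite lee_fin invr_ge0 ltW.
  + apply/measurable_EFinP; apply: continuous_measurable_fun.
    exact: continuous_oneDsqrV.
  + by rewrite invr_ge0 pi_ge0.
- by move=> x y xy; rewrite /F ltr_pM2r// ltrD2r.
- by rewrite F'E => x; exact: cvg_cst.
- by rewrite F'E; exact: is_cvg_cst.
- by rewrite F'E; exact: is_cvg_cst.
- by apply/gt0_cvgMlNy => //; exact: cvg_addrr_Ny.
- by apply/gt0_cvgMly => //; exact: cvg_addrr.
- move=> x; apply: cvgM; first exact: cvg_cst; exact: continuous_oneDsqrV.
- by move=> y; rewrite mulr_ge0 ?invr_ge0 ?pi_ge0// ltW.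
Qed.

End PoissonKernel.

(** * The Plancherel inequality *)

Section Plancherel.
Variable R : realType.
Local Notation mu := (@lebesgue_measure R).
Local Notation L1 f := (mu.-integrable setT (EFin \o f)).
Implicit Types (A B : R -> R) (e x v w : R).

Local Notation Lsq A := (measurable_fun setT A /\ L1 (fun x => A x ^+ 2)).

Lemma measurable_poisson_diff e : 0 < e ->
  measurable_fun [set: measurableTypeR R * measurableTypeR R]
    (fun z => poisson e (z.2 - z.1)).
Proof.
move=> e0.
have := continuous_measurable_fun (continuous_poisson e0).
move=> /(@measurableT_comp _ _ _ _ _ _ (poisson e)); apply.
exact: measurable_funB.
Qed.

Lemma measurable_poisson_shift e w : 0 < e ->
  measurable_fun [set: R] (fun v => poisson e (v - w)).
Proof.
move=> e0.
have := continuous_measurable_fun (continuous_poisson e0).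
move=> /(@measurableT_comp _ _ _ _ _ _ (poisson e)); apply.
exact: measurable_funB.
Qed.

Lemma L1M_poisson A e w : 0 < e -> L1 A -> L1 (fun v => A v * poisson e (v - w)).
Proof.
move=> e0 LA; apply: (L1M_bounded (M := 2 / e) LA).
  exact: measurable_poisson_shift.
by move=> v; rewrite ger0_norm ?poisson_le ?poisson_ge0.
Qed.

(** Tonelli: the kernel also has mass 1 in its other variable, because it is even. *)
Lemma poisson_average_sqr A e : 0 < e -> Lsq A ->
  L1 (fun w => \int[mu]_v (A v ^+ 2 * poisson e (v - w))) /\
  \int[mu]_w (\int[mu]_v (A v ^+ 2 * poisson e (v - w))) = \int[mu]_v (A v ^+ 2).
Proof.
move=> e0 [mA LA].
pose F (z : measurableTypeR R * measurableTypeR R) : \bar R :=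
  (A z.2 ^+ 2 * poisson e (z.2 - z.1))%:E.
have mF : measurable_fun setT F.
  apply/measurable_EFinP; apply: measurable_funM; last exact: measurable_poisson_diff.
  by apply: measurable_funX; exact: measurableT_comp.
have F0 z : (0 <= F z)%E by rewrite lee_fin mulr_ge0 ?sqr_ge0 ?poisson_ge0.
have E w : (\int[mu]_v F (w, v) =
    (\int[mu]_v (A v ^+ 2 * poisson e (v - w)))%:E)%E.
  by rewrite EFin_int//; exact: L1M_poisson.
have I : (\int[mu]_w (\int[mu]_v (A v ^+ 2 * poisson e (v - w)))%:E =
    (\int[mu]_v (A v ^+ 2))%:E)%E.
  transitivity (\int[mu]_w \int[mu]_v F (w, v))%E.
    by apply: eq_integral => w _; rewrite E.
  rewrite (fubini_tonelli F mF F0) EFin_int//.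
  apply: eq_integral => v _; rewrite /F/=.
  transitivity ((A v ^+ 2)%:E * \int[mu]_w (poisson e (w - v))%:E)%E.
    rewrite -ge0_integralZl_EFin ?sqr_ge0//.
    - by apply: eq_integral => w _; rewrite -EFinM -opprB poissonN.
    - by move=> w _; rewrite lee_fin poisson_ge0.
    - by apply/measurable_EFinP; exact: measurable_poisson_shift.
  by rewrite integral_poisson_shift// mule1.
have L : L1 (fun w => \int[mu]_v (A v ^+ 2 * poisson e (v - w))).
  apply: ge0_L1; last by rewrite I ltry.
  - apply/measurable_EFinP.
    have := @measurable_fun_fubini_tonelli_F _ _ _ _ R mu F mF F0.
    by congr (measurable_fun _ _); apply/funext => w; exact: E.
  - move=> w; apply: int_ge0 => v; rewrite mulr_ge0 ?sqr_ge0 ?poisson_ge0//.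
by split => //; apply: EFin_inj; rewrite EFin_int.
Qed.

(* The damped energy equals [int int A(w) A(v) P(v - w) dv dw], which AM-GM bounds
   by [int A^2] because the Poisson kernel is nonnegative of mass 1. *)
Lemma two_sided_exp_energy A e : 0 < e -> L1 A -> Lsq A ->
  \int[mu]_x (two_sided_exp e x * (costr A x ^+ 2 + sintr A x ^+ 2)) <=
  \int[mu]_w (A w ^+ 2).
Proof.
move=> e0 LA [mA LA2]; have Le := L1_two_sided_exp e0.
have LC : L1 (fun x => costr A x * two_sided_exp e x) by exact: L1_costrM.
have LS : L1 (fun x => sintr A x * two_sided_exp e x) by exact: L1_sintrM.
have EC w : costr (fun x => costr A x * two_sided_exp e x) w =
    \int[mu]_v (A v * (2^-1 * (poisson e (v - w) + poisson e (v + w)))).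
  transitivity (\int[mu]_x (costr A x *
      (two_sided_exp e x * cos (2 * pi * x * w)))).
    by apply: eq_int => x; rewrite mulrA.
  rewrite costr_pairing//; last exact: L1_cos.
  by apply: eq_int => v; rewrite costr_exp_cos.
have ES w : sintr (fun x => sintr A x * two_sided_exp e x) w =
    \int[mu]_v (A v * (2^-1 * (poisson e (v - w) - poisson e (v + w)))).
  transitivity (\int[mu]_x (sintr A x *
      (two_sided_exp e x * sin (2 * pi * x * w)))).
    by apply: eq_int => x; rewrite mulrA.
  rewrite sintr_pairing//; last exact: L1_sin.
  by apply: eq_int => v; rewrite sintr_exp_sin.
have LP w : L1 (fun v => A v * poisson e (v - w)) by exact: L1M_poisson.
have LP' w : L1 (fun v => A v * poisson e (v + w)).
  by have := LP (- w); rewrite opprK.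
(* The cosine and sine parts carry the reflected kernel P(v + w) with opposite signs, so it cancels
   in the sum. *)
have ECS w : costr (fun x => costr A x * two_sided_exp e x) w +
    sintr (fun x => sintr A x * two_sided_exp e x) w =
    \int[mu]_v (A v * poisson e (v - w)).
  rewrite EC ES -RintegralD//.
  - by apply: eq_int => v; field.
  - have := L1Z 2^-1 (L1D (LP w) (LP' w)).
    by congr (mu.-integrable _ _); apply/funext => v /=; congr EFin; ring.
  - have := L1Z 2^-1 (L1B (LP w) (LP' w)).
    by congr (mu.-integrable _ _); apply/funext => v /=; congr EFin; ring.
have LCC : L1 (fun w => A w * costr (fun x => costr A x * two_sided_exp e x) w).
  have := L1_costrM LC LA.
  by congr (mu.-integrable _ _); apply/funext => v /=; rewrite mulrC.
have LSS : L1 (fun w => A w * sintr (fun x => sintr A x * two_sided_exp e x) w).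
  have := L1_sintrM LS LA.
  by congr (mu.-integrable _ _); apply/funext => v /=; rewrite mulrC.
have [LPsi IPsi] := poisson_average_sqr e0 (conj mA LA2).
have -> : \int[mu]_x (two_sided_exp e x * (costr A x ^+ 2 + sintr A x ^+ 2)) =
    \int[mu]_w (A w * \int[mu]_v (A v * poisson e (v - w))).
  transitivity (\int[mu]_x (costr A x * (costr A x * two_sided_exp e x) +
     sintr A x * (sintr A x * two_sided_exp e x))).
    by apply: eq_int => x; ring.
  rewrite RintegralD//; [|exact: L1_costrM|exact: L1_sintrM].
  rewrite costr_pairing// sintr_pairing// -RintegralD//.
  by apply: eq_int => w; rewrite -mulrDr ECS.
rewrite -[leRHS](_ : 2^-1 * (\int[mu]_w (A w ^+ 2) +
    \int[mu]_w (\int[mu]_v (A v ^+ 2 * poisson e (v - w)))) = _); last first.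
  by rewrite IPsi; field.
rewrite -RintegralD// -RintegralZl//; last exact: L1D.
apply: le_int.
- have := L1D LCC LSS.
  by congr (mu.-integrable _ _); apply/funext => w /=; rewrite -ECS mulrDr.
- exact/L1Z/L1D.
move=> w.
have IP : \int[mu]_v poisson e (v - w) = 1.
  by rewrite /Rintegral integral_poisson_shift.
have LP1 : L1 (fun v => poisson e (v - w)).
  apply: ge0_L1; first exact: measurable_poisson_shift.
    by move=> v; exact: poisson_ge0.
  by rewrite integral_poisson_shift// ltry.
have LPs : L1 (fun v => A v ^+ 2 * poisson e (v - w)) by exact: L1M_poisson.
have <- : \int[mu]_v (A w ^+ 2 * poisson e (v - w)) = A w ^+ 2.
  by rewrite RintegralZl// IP mulr1.
rewrite -RintegralD//; last exact: L1Z.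
rewrite -!RintegralZl//; last by apply: L1D => //; exact: L1Z.
apply: le_int; first exact: L1Z.
  by apply: L1Z; apply: L1D => //; exact: L1Z.
move=> v; rewrite -mulrDl [leLHS]mulrA [leRHS]mulrA.
apply: ler_wpM2r; first exact: poisson_ge0.
by have := sqr_ge0 (A w - A v); nra.
Qed.

(** The cosine transform is even and the sine transform is odd. Transposing both reduces this to the
    vanishing sine transform of the even function exp(- e |x|) cos. *)
Lemma two_sided_exp_cross A B e : 0 < e -> L1 A -> L1 B ->
  \int[mu]_x (two_sided_exp e x * (costr A x * sintr B x)) = 0.
Proof.
move=> e0 LA LB; have Le := L1_two_sided_exp e0.
have LS : L1 (fun x => sintr B x * two_sided_exp e x) by exact: L1_sintrM.
transitivity (\int[mu]_x (costr A x * (sintr B x * two_sided_exp e x))).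
  by apply: eq_int => x; ring.
rewrite costr_pairing//.
have E w : costr (fun x => sintr B x * two_sided_exp e x) w = 0.
  transitivity (\int[mu]_x (sintr B x *
      (two_sided_exp e x * cos (2 * pi * x * w)))).
    by apply: eq_int => x; rewrite mulrA.
  rewrite sintr_pairing//; last exact: L1_cos.
  under eq_int do rewrite sintr_exp_cos// mulr0.
  by rewrite Rintegral_cst//= mul0r.
under eq_int do rewrite E mulr0.
by rewrite Rintegral_cst//= mul0r.
Qed.

(** [G] is the squared modulus of the inverse transform of A + iB. Damped by exp(- e |x|), its cross
    terms integrate to zero and its squares are bounded by [two_sided_exp_energy]; monotone
    convergence along e = 1 / (n + 1) removes the damping and gives the integrability of [G] as
    well. *)
Lemma trig_plancherel_le A B : L1 A -> Lsq A -> L1 B -> Lsq B ->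
  let G x := (costr A x - sintr B x) ^+ 2 + (sintr A x + costr B x) ^+ 2 in
  L1 G /\ \int[mu]_x G x <= \int[mu]_w (A w ^+ 2) + \int[mu]_w (B w ^+ 2).
Proof.
move=> LA LsA LB LsB G.
set M := _ + _.
have mG : measurable_fun setT G.
  apply: measurable_funD; apply: measurable_funX.
    by apply: measurable_funB; [exact: measurable_costr|exact: measurable_sintr].
  by apply: measurable_funD; [exact: measurable_sintr|exact: measurable_costr].
have G0 x : 0 <= G x by apply: addr_ge0; exact: sqr_ge0.
pose g (n : nat) x := two_sided_exp n.+1%:R^-1 x * G x.
have gn n : L1 (g n) /\ \int[mu]_x g n x <= M.
  rewrite /g; set e : R := n.+1%:R^-1; have e0 : 0 < e by rewrite invr_gt0.
  have Le := L1_two_sided_exp e0.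
  have LC D : L1 D -> L1 (fun x => costr D x * two_sided_exp e x).
    by move=> LD; exact: L1_costrM.
  have LS D : L1 D -> L1 (fun x => sintr D x * two_sided_exp e x).
    by move=> LD; exact: L1_sintrM.
  have Lsq D : L1 D ->
      L1 (fun x => two_sided_exp e x * (costr D x ^+ 2 + sintr D x ^+ 2)).
    move=> LD; have := L1D (L1_costrM LD (LC _ LD)) (L1_sintrM LD (LS _ LD)).
    by congr (mu.-integrable _ _); apply/funext => x /=; congr EFin; ring.
  have Lcr D E : L1 D -> L1 E ->
      L1 (fun x => two_sided_exp e x * (costr D x * sintr E x)).
    move=> LD LE; have := L1_costrM LD (LS _ LE).
    by congr (mu.-integrable _ _); apply/funext => x /=; congr EFin; ring.
  have Eg : (fun x => two_sided_exp e x * G x) = (fun x =>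
      ((two_sided_exp e x * (costr A x ^+ 2 + sintr A x ^+ 2)) +
       (two_sided_exp e x * (costr B x ^+ 2 + sintr B x ^+ 2))) +
      2 * ((two_sided_exp e x * (costr B x * sintr A x)) -
       (two_sided_exp e x * (costr A x * sintr B x)))).
    by apply/funext => x; rewrite /G; ring.
  have L_1 := L1D (Lsq _ LA) (Lsq _ LB).
  have L_2 := L1B (Lcr _ _ LB LA) (Lcr _ _ LA LB).
  rewrite Eg; split; first by apply: L1D => //; exact: L1Z.
  rewrite RintegralD//; last exact: L1Z.
  rewrite RintegralZl// RintegralB//; [|exact: Lcr..].
  rewrite !two_sided_exp_cross// subrr mulr0 addr0.
  rewrite RintegralD//; [|exact: Lsq..].
  by apply: lerD; exact: two_sided_exp_energy.
have gG x : (g n x)%:E @[n --> \oo] --> (G x)%:E.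
  apply: cvg_EFin; first exact: nearW.
  rewrite /g -[X in _ --> X]mul1r; apply: cvgM; last exact: cvg_cst.
  have e0 : - (n.+1%:R^-1 * `|x|) @[n --> \oo] --> (0 : R).
    rewrite -[X in _ --> X]oppr0 -[X in _ --> - X](mul0r `|x|).
    apply: cvgN; apply: cvgM; last exact: cvg_cst.
    exact: cvg_harmonic.
  rewrite -[X in _ --> X]expR0.
  exact: (cvg_comp _ _ e0 (@continuous_expR R 0)).
have IG : (\int[mu]_x (G x)%:E <= M%:E)%E.
  have mono := @cvg_monotone_convergence _ _ R mu setT measurableT
    (fun n x => (g n x)%:E).
  have limE : (fun x => limn (fun n => (g n x)%:E)) = (fun x => (G x)%:E).
    by apply/funext => x; apply/cvg_lim => //; exact: gG.
  have {mono} := mono _ _ _; rewrite limE => mono.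
  have cvgI : (\int[mu]_x (g n x)%:E)%E @[n --> \oo] --> (\int[mu]_x (G x)%:E)%E.
    apply: mono.
    - by move=> n; apply/measurable_EFinP; apply: L1_measurable; have [] := gn n.
    - by move=> n x _; rewrite lee_fin mulr_ge0// expR_ge0.
    - move=> x _ n m nm; rewrite lee_fin ler_wpM2r// ler_expR lerN2.
      by rewrite ler_wpM2r// lef_pV2 ?posrE// ler_nat.
  apply: cvge_le cvgI; apply: nearW => n; have [Lgn Ign] := gn n.
  by rewrite -EFin_int// lee_fin.
have LG : L1 G by apply: ge0_L1 => //; exact: le_lt_trans IG (ltry _).
by split => //; rewrite -lee_fin EFin_int.
Qed.

End Plancherel.

(** * Fourier inversion for compactly supported spectra *)

Section Inversion.
Variable R : realType.
Local Notation mu := (@lebesgue_measure R).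
Local Notation L1 f := (mu.-integrable setT (EFin \o f)).
Implicit Types (A B : R -> R) (e x v w t : R).

Local Notation Lsq A := (measurable_fun setT A /\ L1 (fun x => A x ^+ 2)).

Lemma L1_bounded_Lsq A (M : R) : L1 A -> (forall x, `|A x| <= M) -> Lsq A.
Proof.
move=> LA AM; have mA := L1_measurable LA; split => //.
exact: (L1M_bounded LA mA AM).
Qed.

Lemma L1_poisson e t : 0 < e -> L1 (fun x => poisson e (x - t)).
Proof.
move=> e0; apply: ge0_L1; first exact: measurable_poisson_shift.
  by move=> x; exact: poisson_ge0.
by rewrite integral_poisson_shift// ltry.
Qed.

Lemma int_poisson e t : 0 < e -> \int[mu]_x poisson e (x - t) = 1.
Proof. by move=> e0; rewrite /Rintegral integral_poisson_shift. Qed.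

Lemma normr_poisson_le e x : 0 < e -> `|poisson e x| <= 2 / e.
Proof. by move=> e0; rewrite ger0_norm ?poisson_le ?poisson_ge0. Qed.

Lemma normr_le_sqrD1 x : `|x| <= x ^+ 2 + 1.
Proof.
rewrite -(real_normK (num_real x)).
by have := sqr_ge0 (`|x| - 1); have := normr_ge0 x; nra.
Qed.

Lemma Lsq_poisson_L1 A e t : 0 < e -> Lsq A ->
  L1 (fun x => A x * poisson e (x - t)).
Proof.
move=> e0 [mA LA].
apply: (@L1_le _ _ (fun x => A x ^+ 2 * poisson e (x - t) + poisson e (x - t))).
- by apply: measurable_funM => //; exact: measurable_poisson_shift.
- move=> x; rewrite normrM (ger0_norm (poisson_ge0 _ e0)).
  rewrite [leRHS](_ : _ = (A x ^+ 2 + 1) * poisson e (x - t)); last by ring.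
  by apply: ler_wpM2r; [exact: poisson_ge0|exact: normr_le_sqrD1].
- by apply: L1D; [exact: L1M_poisson|exact: L1_poisson].
Qed.

(** Away from the origin the kernel is O(e) times the fixed integrable kernel [poisson 1], which
    makes the tail error linear in [e]. *)
Lemma poisson_tail e (d y : R) : 0 < e -> 0 < d -> d <= `|y| ->
  poisson e y <= e * ((1 + d ^- 2) * poisson 1 y).
Proof.
move=> e0 d0 dy; rewrite /poisson expr1n mulr1.
set b := 2 * pi * y.
have db : d ^+ 2 <= b ^+ 2.
  rewrite -(real_normK (num_real b)) lerXn2r ?nnegrE ?(ltW d0)//.
  rewrite (le_trans dy)// /b normrM ler_peMl//.
  have p2 := @pi_ge2 R; rewrite ger0_norm; lra.
have d20 : 0 < d ^+ 2 by rewrite exprn_gt0.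
have b20 : 0 < b ^+ 2 by exact: lt_le_trans db.
have e20 : 0 < e ^+ 2 by rewrite exprn_gt0.
rewrite ler_pdivrMr ?addr_gt0//.
rewrite (_ : e * _ * _ =
  2 * e * ((1 + d ^- 2) * (e ^+ 2 + b ^+ 2) / (1 + b ^+ 2))); last first.
  by field; rewrite !lt0r_neq0// addr_gt0.
rewrite ler_peMr ?mulr_ge0 ?(ltW e0)// ler_pdivlMr ?addr_gt0// mul1r.
have h : 1 <= d ^- 2 * b ^+ 2 by rewrite mulrC ler_pdivlMr// mul1r.
have h2 : 0 <= d ^- 2 * e ^+ 2 by rewrite mulr_ge0 ?invr_ge0 ?ltW.
rewrite mulrDl mul1r mulrDr.
by move: h h2 e20; set X := d ^- 2 * _; set Y := d ^- 2 * _; lra.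
Qed.

(** Continuity at [t] controls the points within d of [t] and gives [eta]; the remaining points give
    [e * C], where C depends on [eta] through d but not on [e]. *)
Lemma poisson_approximate_identity A t (eta : R) : 0 < eta ->
  continuous A -> Lsq A -> exists C : R, forall e, 0 < e ->
  `|\int[mu]_x (A x * poisson e (x - t)) - A t| <= eta + e * C.
Proof.
move=> eta0 cA [mA LA].
have /cvgrPdist_lt/(_ _ eta0) [d /= d0 hd] := cA t.
(* As [A] need not be bounded, far from [t] the difference |A x - A t| is estimated by A x ^ 2 + 1 +
   |A t|. The square is integrable by itself, and its kernel factor is replaced by the bound
   [poisson 1] <= 2; the constant keeps the kernel. *)
pose T x := (1 + d ^- 2) * (2 * A x ^+ 2 + (1 + `|A t|) * poisson 1 (x - t)).
have LT : L1 T.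
  by apply: L1Z; apply: L1D; apply: L1Z => //; exact: L1_poisson.
exists (\int[mu]_x T x) => e e0.
have -> : \int[mu]_x (A x * poisson e (x - t)) - A t =
    \int[mu]_x (A x * poisson e (x - t) - A t * poisson e (x - t)).
  rewrite RintegralB//.
  - by rewrite RintegralZl ?int_poisson ?mulr1//; exact: L1_poisson.
  - exact: Lsq_poisson_L1.
  - by apply: L1Z; exact: L1_poisson.
have -> : eta + e * \int[mu]_x T x =
    \int[mu]_x (eta * poisson e (x - t) + e * T x).
  rewrite RintegralD//; last exact: L1Z.
  - rewrite (RintegralZl _ measurableT (L1_poisson t e0)) int_poisson// mulr1.
    by rewrite (RintegralZl _ measurableT LT).
  - by apply: L1Z; exact: L1_poisson.
apply: normr_int_le.
- apply: L1B; first exact: Lsq_poisson_L1.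
  by apply: L1Z; exact: L1_poisson.
- by apply: L1D; apply: L1Z => //; exact: L1_poisson.
move=> x; have P0 := poisson_ge0 (x - t) e0.
rewrite -mulrBl normrM (ger0_norm P0).
have d20 : 0 <= d ^- 2 by rewrite invr_ge0 exprn_ge0// ltW.
have P10 := poisson_ge0 (x - t) (@ltr01 R).
have T0 : 0 <= T x.
  apply: mulr_ge0; first by rewrite addr_ge0.
  apply: addr_ge0; first by apply: mulr_ge0 => //; exact: sqr_ge0.
  by apply: mulr_ge0 => //; rewrite addr_ge0.
have [xt|xt] := ltP `|t - x| d.
  rewrite -[leLHS]addr0; apply: lerD; last by rewrite mulr_ge0// ltW.
  by apply: ler_wpM2r => //; rewrite distrC ltW//; exact: hd.
rewrite distrC in xt.
have tail := poisson_tail e0 d0 xt.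
rewrite -[leLHS]add0r; apply: lerD; first by rewrite mulr_ge0// ltW.
apply: (le_trans (ler_wpM2l (normr_ge0 _) tail)).
rewrite mulrCA; apply: ler_wpM2l; first exact: ltW.
rewrite /T mulrCA; apply: ler_wpM2l; first by rewrite addr_ge0.
have h1 : `|A x - A t| <= A x ^+ 2 + (1 + `|A t|).
  by rewrite addrA (le_trans (ler_normB _ _))// lerD2r normr_le_sqrD1.
apply: (le_trans (ler_wpM2r P10 h1)); rewrite mulrDl lerD2r mulrC ler_wpM2r ?sqr_ge0//.
by have := poisson_le (x - t) (@ltr01 R); rewrite divr1.
Qed.

Variables (f1 f2 g1 g2 : R -> R) (a : R).
(** Taken as a hypothesis because [g1] and [g2] will be truncations of the spectrum, which agree
    with it almost everywhere only; the integrals against [A] do not see the change. *)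
Hypothesis pairing : forall A, L1 A -> Lsq A -> Lsq (costr A) -> Lsq (sintr A) ->
  \int[mu]_w (g1 w * A w) =
    \int[mu]_x (f1 x * costr A x) + \int[mu]_x (f2 x * sintr A x) /\
  \int[mu]_w (g2 w * A w) =
    \int[mu]_x (f2 x * costr A x) - \int[mu]_x (f1 x * sintr A x).
Hypotheses (cf1 : continuous f1) (cf2 : continuous f2).
Hypotheses (Lf1 : Lsq f1) (Lf2 : Lsq f2) (Lg1 : L1 g1) (Lg2 : L1 g2).
Hypothesis supp_g1 : forall w, a < `|w| -> g1 w = 0.
Hypothesis supp_g2 : forall w, a < `|w| -> g2 w = 0.

(** On the band, 0 <= 1 - exp(- e |w|) <= e |w| <= e a. *)
Let damping_error B (k : R -> R) e : 0 < e -> L1 B ->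
  (forall w, a < `|w| -> B w = 0) ->
  measurable_fun setT k -> (forall w, `|k w| <= 1) ->
  `|\int[mu]_w (B w * (two_sided_exp e w * k w)) - \int[mu]_w (B w * k w)| <=
  e * (a * \int[mu]_w `|B w|).
Proof.
move=> e0 LB suppB mk k1.
have LBk : L1 (fun w => B w * k w) by exact: (L1M_bounded LB mk k1).
have LBek : L1 (fun w => B w * (two_sided_exp e w * k w)).
  apply: (@L1M_bounded _ _ _ 1) => //.
    by apply: measurable_funM => //; exact: measurable_two_sided_exp.
  move=> w; rewrite normrM mulr_ile1//.
  exact/normr_two_sided_exp_le1/ltW.
rewrite -RintegralB// mulrA -RintegralZl//; last exact: L1_norm.
apply: normr_int_le; first exact: L1B.
  by apply: L1Z; exact: L1_norm.
move=> w; have [wa|wa] := ltP a `|w|; first by rewrite suppB// !mul0r subr0 normr0 mulr0.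
rewrite -mulrBr -{2}[k w]mul1r -mulrBl normrM mulrC; apply: ler_wpM2r => //.
rewrite normrM -[leRHS]mulr1; apply: ler_pM => //.
rewrite distrC ger0_norm; last by rewrite subr_ge0 two_sided_exp_le1// ltW.
rewrite lerBlDr -lerBlDl.
apply: (@le_trans _ _ (1 + - (e * `|w|))); last exact: expR_ge1Dx.
by rewrite lerD2l lerN2 ler_wpM2l// ltW.
Qed.

Let Lsq_poisson_comb (s e t : R) : 0 < e ->
  Lsq (fun x => 2^-1 * (poisson e (x - t) + s * poisson e (x + t))).
Proof.
move=> e0; apply: (@L1_bounded_Lsq _ (2^-1 * (2 / e + `|s| * (2 / e)))).
  apply: L1Z; apply: L1D; first exact: L1_poisson.
  by apply: L1Z; have := L1_poisson (- t) e0; rewrite opprK.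
move=> x; rewrite normrM ger0_norm// ler_wpM2l//.
rewrite (le_trans (ler_normD _ _))// lerD ?normr_poisson_le// normrM.
by rewrite ler_wpM2l// normr_poisson_le.
Qed.

Let Lsq0 : Lsq (fun _ : R => 0 : R).
Proof.
split => //; rewrite (_ : EFin \o _ = cst 0%E); first exact: integrable0.
by apply/funext => x /=; rewrite expr0n.
Qed.

(** The damped cosine is even, so its sine transform vanishes and one term of each pairing survives;
    for the damped sine below it is the other one. *)
Let exp_cos_pairing e t : 0 < e ->
  let P x := 2^-1 * (poisson e (x - t) + poisson e (x + t)) in
  \int[mu]_w (g1 w * (two_sided_exp e w * cos (2 * pi * w * t))) =
    \int[mu]_x (f1 x * P x) /\
  \int[mu]_w (g2 w * (two_sided_exp e w * cos (2 * pi * w * t))) =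
    \int[mu]_x (f2 x * P x).
Proof.
move=> e0 P; have Le := L1_two_sided_exp e0.
pose A w := two_sided_exp e w * cos (2 * pi * w * t).
have LA : L1 A by exact: L1_cos.
have CA : costr A = P by apply/funext => x; exact: costr_exp_cos.
have SA : sintr A = fun _ => 0 by apply/funext => x; exact: sintr_exp_cos.
have [] := pairing LA _ _ _.
- apply: (@L1_bounded_Lsq _ 1) => // w; rewrite normrM; apply: mulr_ile1 => //.
    exact/normr_two_sided_exp_le1/ltW.
  exact: normr_cos_le1.
- rewrite CA; suff -> : P = fun x => 2^-1 * (poisson e (x - t) + 1 * poisson e (x + t)).
    exact: Lsq_poisson_comb.
  by apply/funext => x; rewrite /P mul1r.
- by rewrite SA; exact: Lsq0.
rewrite CA SA => -> ->.
have z (f : R -> R) : \int[mu]_x (f x * 0) = 0.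
  under eq_int do rewrite mulr0.
  by rewrite Rintegral_cst//= mul0r.
by rewrite !z addr0 subr0.
Qed.

Let exp_sin_pairing e t : 0 < e ->
  let P x := 2^-1 * (poisson e (x - t) - poisson e (x + t)) in
  \int[mu]_w (g1 w * (two_sided_exp e w * sin (2 * pi * w * t))) =
    \int[mu]_x (f2 x * P x) /\
  \int[mu]_w (g2 w * (two_sided_exp e w * sin (2 * pi * w * t))) =
    - \int[mu]_x (f1 x * P x).
Proof.
move=> e0 P; have Le := L1_two_sided_exp e0.
pose A w := two_sided_exp e w * sin (2 * pi * w * t).
have LA : L1 A by exact: L1_sin.
have SA : sintr A = P by apply/funext => x; exact: sintr_exp_sin.
have CA : costr A = fun _ => 0 by apply/funext => x; exact: costr_exp_sin.
have [] := pairing LA _ _ _.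
- apply: (@L1_bounded_Lsq _ 1) => // w; rewrite normrM; apply: mulr_ile1 => //.
    exact/normr_two_sided_exp_le1/ltW.
  exact: normr_sin_le1.
- by rewrite CA; exact: Lsq0.
- rewrite SA; suff -> : P = fun x => 2^-1 * (poisson e (x - t) + (-1) * poisson e (x + t)).
    exact: Lsq_poisson_comb.
  by apply/funext => x; rewrite /P mulN1r.
rewrite CA SA => -> ->.
have z (f : R -> R) : \int[mu]_x (f x * 0) = 0.
  under eq_int do rewrite mulr0.
  by rewrite Rintegral_cst//= mul0r.
by rewrite !z add0r sub0r.
Qed.

Let combine (f : R -> R) e t : 0 < e -> Lsq f ->
  \int[mu]_x (f x * (2^-1 * (poisson e (x - t) + poisson e (x + t)))) +
  \int[mu]_x (f x * (2^-1 * (poisson e (x - t) - poisson e (x + t)))) =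
  \int[mu]_x (f x * poisson e (x - t)).
Proof.
move=> e0 Lf; have Lp := Lsq_poisson_L1 t e0 Lf.
have Lm : L1 (fun x => f x * poisson e (x + t)).
  by have := Lsq_poisson_L1 (- t) e0 Lf; rewrite opprK.
rewrite -RintegralD//.
- by apply: eq_int => x; field.
- have := L1Z 2^-1 (L1D Lp Lm).
  by congr (mu.-integrable _ _); apply/funext => v /=; congr EFin; ring.
- have := L1Z 2^-1 (L1B Lp Lm).
  by congr (mu.-integrable _ _); apply/funext => v /=; congr EFin; ring.
Qed.

(** As C may depend on [eta], first eta = |x - y| / 4 is fixed and then e = eta / (1 + |C|); the
    bound becomes at most |x - y| / 2. *)
Let small_eq (x y : R) : (forall eta, 0 < eta -> exists C : R, forall e, 0 < e ->
  `|x - y| <= eta + e * C) -> x = y.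
Proof.
move=> h; apply/eqP; rewrite -subr_eq0 -normr_le0 leNgt; apply/negP => xy.
have [|C hC] := h (`|x - y| / 4); first by rewrite divr_gt0.
have C0 : 0 < 1 + `|C| by rewrite ltr_pwDl.
have := hC (`|x - y| / 4 / (1 + `|C|)).
rewrite divr_gt0 ?divr_gt0// => /(_ isT).
have : `|x - y| / 4 / (1 + `|C|) * C <= `|x - y| / 4.
  rewrite mulrAC ler_pdivrMr// ler_wpM2l ?divr_ge0//.
  by rewrite (le_trans (ler_norm _))// lerDr.
by move: xy; set X := `|x - y|; set Y := _ * C; lra.
Qed.

(** Abel summation: the inversion integral damped by exp(- e |w|) equals the Poisson average of [f1]
    around [t] exactly, by the two pairings and [combine]. As e tends to 0 the average tends to
    f1(t) and the damping error to 0. *)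
Lemma inversion_re t : f1 t = costr g1 t - sintr g2 t.
Proof.
apply: small_eq => eta eta0.
have [C hC] := poisson_approximate_identity t eta0 cf1 Lf1.
exists (C + (a * \int[mu]_w `|g1 w|) + (a * \int[mu]_w `|g2 w|)) => e e0.
have := hC e e0.
have := damping_error e0 Lg1 supp_g1 (measurable_cosw t) (fun w => normr_cos_le1 _).
have := damping_error e0 Lg2 supp_g2 (measurable_sinw t) (fun w => normr_sin_le1 _).
rewrite -!/(costr _ _) -!/(sintr _ _) -(combine t e0 Lf1).
have [-> _] := exp_cos_pairing t e0; have [_ ->] := exp_sin_pairing t e0.
rewrite !ler_norml !mulrDr => /andP[? ?] /andP[? ?] /andP[? ?].
by apply/andP; split; lra.
Qed.

Lemma inversion_im t : f2 t = sintr g1 t + costr g2 t.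
Proof.
apply: small_eq => eta eta0.
have [C hC] := poisson_approximate_identity t eta0 cf2 Lf2.
exists (C + (a * \int[mu]_w `|g1 w|) + (a * \int[mu]_w `|g2 w|)) => e e0.
have := hC e e0.
have := damping_error e0 Lg1 supp_g1 (measurable_sinw t) (fun w => normr_sin_le1 _).
have := damping_error e0 Lg2 supp_g2 (measurable_cosw t) (fun w => normr_cos_le1 _).
rewrite -!/(costr _ _) -!/(sintr _ _) -(combine t e0 Lf2).
have [_ ->] := exp_cos_pairing t e0; have [-> _] := exp_sin_pairing t e0.
rewrite !ler_norml !mulrDr => /andP[? ?] /andP[? ?] /andP[? ?].
by apply/andP; split; lra.
Qed.

End Inversion.

(** * Derivatives of band-limited functions *)

Section Bandlimited.
Variable R : realType.
Local Notation mu := (@lebesgue_measure R).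
Local Notation L1 f := (mu.-integrable setT (EFin \o f)).
Implicit Types (A B : R -> R) (x y w b t : R).

Definition freq_mul A (w : R) : R := 2 * pi * w * A w.

Lemma is_derive_costr A x : L1 A -> L1 (freq_mul A) ->
  is_derive x 1 (costr A) (- sintr (freq_mul A) x).
Proof.
move=> LA LD.
pose f (y : R) (w : measurableTypeR R) : R := A w * cos (2 * pi * w * y).
have df y w : is_derive y 1 (f ^~ w) (- (freq_mul A w * sin (2 * pi * w * y))).
  have dC := is_derive1_comp_affine (is_derive_cos (2 * pi * w * y + 0)).
  have := is_derive1Z (A w) dC.
  rewrite (_ : (fun t => _) = f ^~ w); last first.
    by apply/funext => t; rewrite /f addr0.
  by move=> H; apply: (is_derive_eq H); rewrite /freq_mul addr0; ring.
have Ix : `]x - 1, x + 1[%classic x.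
  by rewrite /= in_itv/=; apply/andP; split; lra.
have iF y : `]x - 1, x + 1[%classic y -> L1 (f y) by move=> _; exact: L1_cos.
have dF y w : `]x - 1, x + 1[%classic y -> setT w -> derivable (f ^~ w) y 1.
  by move=> _ _; have [] := df y w.
have G0 w : 0 <= `|freq_mul A w| by [].
have GL := L1_norm LD.
have Gub y w : `]x - 1, x + 1[%classic y -> setT w ->
    `|partial1of2 f y w| <= `|freq_mul A w|.
  move=> _ _; rewrite partial1of2E; have [_ ->] := df y w.
  by rewrite normrN normrM ler_piMr// normr_sin_le1.
split.
  exact: (derivable_under_integral measurableT Ix iF dF G0 GL Gub).
rewrite -derive1E.
rewrite (differentiation_under_integral measurableT Ix iF dF G0 GL Gub).
rewrite /sintr -[RHS]mulN1r -RintegralZl//; last exact: L1_sin.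
apply: eq_int => w; rewrite partial1of2E; have [_ ->] := df x w.
by rewrite mulN1r.
Qed.

Lemma is_derive_sintr A x : L1 A -> L1 (freq_mul A) ->
  is_derive x 1 (sintr A) (costr (freq_mul A) x).
Proof.
move=> LA LD.
pose f (y : R) (w : measurableTypeR R) : R := A w * sin (2 * pi * w * y).
have df y w : is_derive y 1 (f ^~ w) (freq_mul A w * cos (2 * pi * w * y)).
  have dC := is_derive1_comp_affine (is_derive_sin (2 * pi * w * y + 0)).
  have := is_derive1Z (A w) dC.
  rewrite (_ : (fun t => _) = f ^~ w); last first.
    by apply/funext => t; rewrite /f addr0.
  by move=> H; apply: (is_derive_eq H); rewrite /freq_mul addr0; ring.
have Ix : `]x - 1, x + 1[%classic x.
  by rewrite /= in_itv/=; apply/andP; split; lra.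
have iF y : `]x - 1, x + 1[%classic y -> L1 (f y) by move=> _; exact: L1_sin.
have dF y w : `]x - 1, x + 1[%classic y -> setT w -> derivable (f ^~ w) y 1.
  by move=> _ _; have [] := df y w.
have G0 w : 0 <= `|freq_mul A w| by [].
have GL := L1_norm LD.
have Gub y w : `]x - 1, x + 1[%classic y -> setT w ->
    `|partial1of2 f y w| <= `|freq_mul A w|.
  move=> _ _; rewrite partial1of2E; have [_ ->] := df y w.
  by rewrite normrM ler_piMr// normr_cos_le1.
split.
  exact: (derivable_under_integral measurableT Ix iF dF G0 GL Gub).
rewrite -derive1E.
rewrite (differentiation_under_integral measurableT Ix iF dF G0 GL Gub).
by apply: eq_int => w; rewrite partial1of2E; have [_ ->] := df x w.
Qed.

Variable a : R.
Hypothesis a0 : 0 < a.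

Definition band A := L1 A /\ forall w, a < `|w| -> A w = 0.

Lemma normr_freq_mul A w : band A -> `|freq_mul A w| <= 2 * pi * a * `|A w|.
Proof.
move=> [_ sA]; have [/sA Aw|wa] := ltP a `|w|.
  by rewrite /freq_mul Aw mulr0 normr0 mulr0.
rewrite normrM ler_wpM2r// normrM ger0_norm ?mulr_ge0 ?pi_ge0//.
by rewrite ler_wpM2l// mulr_ge0// pi_ge0.
Qed.

Lemma measurable_freq_mul A : measurable_fun setT A ->
  measurable_fun setT (freq_mul A).
Proof. by move=> mA; apply: measurable_funM => //; exact: measurable_funM. Qed.

Lemma band_freq_mul A : band A -> band (freq_mul A).
Proof.
move=> bA; have [LA sA] := bA; split; last first.
  by move=> w /sA; rewrite /freq_mul => ->; rewrite mulr0.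
apply: (@L1_le _ _ (fun w => 2 * pi * a * `|A w|)).
- exact: measurable_freq_mul (L1_measurable LA).
- by move=> w; exact: normr_freq_mul.
- exact/L1Z/L1_norm.
Qed.

Lemma int_freq_mul A : band A ->
  \int[mu]_w `|freq_mul A w| <= 2 * pi * a * \int[mu]_w `|A w|.
Proof.
move=> bA; have [LA _] := bA; have [LD _] := band_freq_mul bA.
rewrite -RintegralZl//; last exact: L1_norm.
apply: le_int; [exact: L1_norm|exact/L1Z/L1_norm|].
by move=> w; exact: normr_freq_mul.
Qed.

Lemma bandN A : band A -> band (fun w => - A w).
Proof. by move=> [LA sA]; split=> [|w /sA ->]; rewrite ?oppr0//; exact: L1N. Qed.

Lemma sintrN A x : L1 A -> sintr (fun w => - A w) x = - sintr A x.
Proof.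
move=> LA; rewrite /sintr -[RHS]mulN1r -RintegralZl//; last exact: L1_sin.
by apply: eq_int => w; ring.
Qed.

(** One differentiation turns costr A + sintr B into costr (freq_mul B) + sintr (- freq_mul A), so
    the derivatives of all orders keep the same shape. *)
Fixpoint deriv_amplitudes (AB : (R -> R) * (R -> R)) (k : nat) :=
  if k is k'.+1 then let AB' := deriv_amplitudes AB k' in
    (freq_mul AB'.2, fun w => - freq_mul AB'.1 w)
  else AB.

Lemma deriv_amplitudes_bound A B k : band A -> band B ->
  let AB := deriv_amplitudes (A, B) k in
  [/\ band AB.1, band AB.2 &
    \int[mu]_w `|AB.1 w| + \int[mu]_w `|AB.2 w| <=
    (\int[mu]_w `|A w| + \int[mu]_w `|B w|) * (2 * pi * a) ^+ k].
Proof.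
move=> bA bB; elim: k => [|k [b1 b2 IH]] /=; first by split; rewrite ?mulr1.
split; [exact: band_freq_mul|exact/bandN/band_freq_mul|].
under [X in _ + X <= _]eq_int do rewrite normrN.
rewrite exprS mulrCA; apply: le_trans (ler_wpM2l _ IH).
  by rewrite mulrDr addrC lerD// int_freq_mul.
by rewrite mulr_ge0 ?(ltW a0)// mulr_ge0// pi_ge0.
Qed.

Lemma band_clustering_zeros A B b t : band A -> band B ->
  zeros_cluster (fun x => costr A x + sintr B x) b ->
  costr A t + sintr B t = 0.
Proof.
move=> bA bB za.
pose F k x := costr (deriv_amplitudes (A, B) k).1 x +
              sintr (deriv_amplitudes (A, B) k).2 x.
apply: (@vanishing_of_clustering_zeros R F _
  (\int[mu]_w `|A w| + \int[mu]_w `|B w|) (2 * pi * a) _ _ b) => //.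
- move=> k x; have [b1 b2 _] := deriv_amplitudes_bound k bA bB.
  have [L1_ _] := b1; have [L2_ _] := b2.
  have [L1' _] := band_freq_mul b1; have [L2' _] := band_freq_mul b2.
  rewrite /F/= sintrN// addrC.
  by apply: is_derive1D; [exact: is_derive_costr|exact: is_derive_sintr].
- by rewrite mulr_gt0// mulr_gt0// pi_gt0.
- move=> k x; have [[L1_ _] [L2_ _] bd] := deriv_amplitudes_bound k bA bB.
  apply: le_trans bd; rewrite (le_trans (ler_normD _ _))// lerD//.
    exact: normr_costr.
  exact: normr_sintr.
Qed.

End Bandlimited.

(** * Essential support and coverings by segments *)

Section SupportAndCovering.
Variable R : realType.
Local Notation mu := (@lebesgue_measure R).
Local Notation L1 f := (mu.-integrable setT (EFin \o f)).

(** A Lindelof argument: every point off the support lies in an interval with rational ends on which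
    [g] vanishes almost everywhere, and there are countably many of these. [S n] collects the
    exceptional points of the n-th such interval and is empty when [g] does not vanish almost
    everywhere there. *)
Lemma ess_support_ae (g : R -> R[i]) :
  {ae mu, forall t, ~ ess_support g t -> g t = 0}.
Proof.
pose J (n : nat) : set R := if @unpickle (rat * rat)%type n is Some pq then
  [set t : R | ratr pq.1 < t < ratr pq.2] else set0.
pose S n := [set t | {ae mu, forall s, J n s -> g s = 0} /\ J n t /\ g t <> 0].
have nS n : mu.-negligible (S n).
  have [h|h] := pselect {ae mu, forall s, J n s -> g s = 0}.
    apply: negligibleS h => t [_ [Jt gt]] /= H; exact: gt (H Jt).
  by apply: negligibleS (@negligible_set0 _ _ _ mu) => t [/h].
apply: negligibleS (negligible_bigcup nS) => t /= /not_implyP[nsupp gt].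
have [U [Ut aeU]] : exists U : set R, nbhs t U /\
    {ae mu, forall s, U s -> g s = 0}.
  apply: contra_notP nsupp => nU U Ut aeU; apply: nU; by exists U.
have [e /= e0 eU] := Ut.
have [p] := @rat_in_itvoo R (t - e) t ltac:(by rewrite ltrBlDr ltrDl).
have [q] := @rat_in_itvoo R t (t + e) ltac:(by rewrite ltrDl).
rewrite !in_itv/= => /andP[tq qe] /andP[pe pt].
have [n Jn] : exists n, J n = [set t : R | ratr p < t < ratr q].
  by exists (pickle (p, q)); rewrite /J pickleK.
exists n; first exact: I.
rewrite /S /= Jn; split; last by split=> //=; rewrite pt tq.
apply: negligibleS aeU => s /= /not_implyP[/andP[ps sq] gs] H.
apply: gs; apply: H; apply: eU => /=.
rewrite ltr_norml; apply/andP; split; lra.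
Qed.

Lemma ae_eq_int (f g : R -> R) : measurable_fun setT f -> measurable_fun setT g ->
  {ae mu, forall t, f t = g t} -> \int[mu]_t f t = \int[mu]_t g t.
Proof.
move=> mf mg fg; rewrite /Rintegral; congr fine.
apply: ae_eq_integral => //; [exact/measurable_EFinP|exact/measurable_EFinP|].
apply: negligibleS fg => t /= /not_implyP[_ ne] H; apply: ne.
by rewrite H.
Qed.

Section IntSequence.
Variable x : int -> R.
Hypothesis hx : forall i : int, x i < x (i + 1).

Lemma int_seq_le (i j : int) : i <= j -> x i <= x j.
Proof.
move=> ij; have -> : j = i + `|j - i|%N%:Z.
  by rewrite gez0_abs ?subr_ge0//; ring.
elim: `|j - i|%N => [|n IH]; first by rewrite addr0.
by rewrite (le_trans IH)// -addn1 PoszD addrA ltW.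
Qed.

(** The segments from x(-n) to x(n) exhaust the line, since the sequence is unbounded in both
    directions; dominated convergence with majorant |k| passes to the limit. *)
Lemma int_ge0_of_segments (k : R -> R) : L1 k ->
  (forall i, 0 <= \int[mu]_(t in `[x i, x (i + 1)]) k t) ->
  (forall t, exists i, t < x i) -> (forall t, exists i, x i < t) ->
  0 <= \int[mu]_t k t.
Proof.
move=> Lk k0 ub lb.
have ik (a b : R) : mu.-integrable `[a, b] (EFin \o k).
  exact: integrableS Lk.
pose I (n : nat) : set R := `[x (- n%:Z), x n%:Z]%classic.
have I0 n : 0 <= \int[mu]_(t in I n) k t.
  elim: n => [|n IH]; first by rewrite /I oppr0 set_itv1 Rintegral_set1.
  have e1 : (- n.+1%:Z + 1 = - n%:Z)%R by rewrite -addn1 PoszD opprD subrK.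
  have e2 : (n%:Z + 1 = n.+1%:Z)%R by rewrite -addn1 PoszD.
  rewrite /I (@int_segment_split _ _ _ (x (- n%:Z)))//; last 2 first.
  - by rewrite -e1 ltW.
  - by apply: int_seq_le; lia.
  rewrite (@int_segment_split _ _ _ (x n%:Z) (x n.+1%:Z))//; last 2 first.
  - by apply: int_seq_le; lia.
  - by rewrite -e2 ltW.
  rewrite addr_ge0//; first by have := k0 (- n.+1%:Z); rewrite e1.
  by rewrite addr_ge0//; have := k0 n%:Z; rewrite e2.
have mI n : measurable (I n) by exact: measurable_itv.
have mk := L1_measurable Lk.
have [||||_ _ H] := @dominated_convergence _ _ R mu setT measurableT
  (fun n t => ((k \_ (I n)) t)%:E) (EFin \o k) (fun t => `|k t|%:E) _ _ _
  (L1_norm Lk).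
- move=> n; apply/measurable_EFinP.
  have mkI : measurable_fun (I n) k by exact: measurable_funTS.
  exact: (measurable_restrictT k (mI n)).1 mkI.
- exact/measurable_EFinP.
- apply: aeW => t _; have [i ti] := ub t; have [j jt] := lb t.
  apply: cvg_near_cst.
  exists (maxn `|i| `|j|)%N => // n /=; rewrite geq_max => /andP[ni nj].
  rewrite patchE mem_set//= /I /= in_itv/=; apply/andP; split.
    by rewrite (le_trans _ (ltW jt))//; apply: int_seq_le; lia.
  by rewrite (le_trans (ltW ti))//; apply: int_seq_le; lia.
- apply: aeW => t n _; rewrite patchE.
  by case: ifP => _; rewrite lee_fin ?normr0.
rewrite -lee_fin EFin_int//; apply: cvge_ge H; apply: nearW => n.
apply: (@le_trans _ _ (\int[mu]_(t in I n) (k t)%:E)%E).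
  rewrite -(fineK (integrable_fin_num _ (ik _ _)))// lee_fin.
  exact: I0.
rewrite integral_mkcond le_eqVlt; apply/orP; left; apply/eqP.
by apply: eq_integral => t _; rewrite !patchE; case: ifP.
Qed.

Lemma bounded_int_seq_clusters (f : R -> R) : (forall i, f (x i) = 0) ->
  ~ ((forall t, exists i, t < x i) /\ (forall t, exists i, x i < t)) ->
  exists b, zeros_cluster f b.
Proof.
move=> fx /not_andP[] /existsNP[T /forallNP hT].
- have bT i : x i <= T by rewrite leNgt; apply/negP; exact: hT.
  have hs : has_sup (range x).
    by split; [exists (x 0), 0|exists T => _ [i _ <-]].
  exists (sup (range x)) => e e0.
  have [_ [i _ <-] ie] := sup_adherent e0 hs.
  (* Strict monotonicity keeps the supremum from being attained, so the zeros found near it differ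
     from it. *)
  have isup : x i < sup (range x).
    by apply: (lt_le_trans (hx i)); apply: ub_le_sup; [exact: hs.2|exists (i + 1)].
  exists (x i); split => //; first by rewrite lt_eqF.
  by rewrite ltr0_norm ?subr_lt0// opprB; lra.
- have bT i : T <= x i by rewrite leNgt; apply/negP; exact: hT.
  have hs : has_inf (range x).
    by split; [exists (x 0), 0|exists T => _ [i _ <-]].
  exists (inf (range x)) => e e0.
  have [_ [i _ <-] ie] := inf_adherent e0 hs.
  have isup : inf (range x) < x i.
    have := hx (i - 1); rewrite subrK => /(le_lt_trans _); apply.
    by apply: ge_inf; [exact: hs.2|exists (i - 1)].
  exists (x i); split => //; first by rewrite gt_eqF.
  by rewrite gtr0_norm ?subr_gt0//; lra.
Qed.

End IntSequence.
End SupportAndCovering.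

(** * Uniqueness from double zeros *)

Section Uniqueness.
Variable R : realType.
Local Notation mu := (@lebesgue_measure R).
Local Notation L1 f := (mu.-integrable setT (EFin \o f)).
Local Notation Lsq A := (measurable_fun setT A /\ L1 (fun x => A x ^+ 2)).

Lemma Lsq_freq_mul a A : 0 < a -> band a A -> Lsq A -> Lsq (freq_mul A).
Proof.
move=> a0 bA [mA LA]; split; first exact: measurable_freq_mul.
apply: (@L1_le _ _ (fun w => (2 * pi * a) ^+ 2 * A w ^+ 2)).
- by apply: measurable_funX; exact: measurable_freq_mul.
- move=> w; rewrite ger0_norm ?sqr_ge0// -(real_normK (num_real (freq_mul A w))).
  rewrite -(real_normK (num_real (A w))) -exprMn lerXn2r ?nnegrE//.
    by rewrite mulr_ge0// mulr_ge0 ?(ltW a0)// mulr_ge0// pi_ge0.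
  exact: normr_freq_mul.
- exact: L1Z.
Qed.

(** The Plancherel inequality with second amplitude zero; it makes [A] admissible in the pairing. *)
Lemma Lsq_trig A : L1 A -> Lsq A -> Lsq (costr A) /\ Lsq (sintr A).
Proof.
move=> LA LsA.
have L0 : L1 (fun _ : R => 0 : R).
  by have := L1Z 0 LA; congr (mu.-integrable _ _); apply/funext => x /=; rewrite mul0r.
have Ls0 : Lsq (fun _ : R => 0 : R).
  split => //; have := L0; congr (mu.-integrable _ _).
  by apply/funext => x /=; rewrite expr0n.
have z0 x : costr (fun _ : R => 0 : R) x = 0.
  rewrite /costr; under eq_int do rewrite mul0r.
  by rewrite Rintegral_cst//= mul0r.
have z1 x : sintr (fun _ : R => 0 : R) x = 0.
  rewrite /sintr; under eq_int do rewrite mul0r.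
  by rewrite Rintegral_cst//= mul0r.
have [LG _] := trig_plancherel_le LA LsA L0 Ls0.
have mC := measurable_costr LA; have mS := measurable_sintr LA.
split; split => //; apply: L1_le LG; try exact: measurable_funX.
- by move=> x; rewrite z0 z1 subr0 addr0 ger0_norm ?sqr_ge0// lerDl sqr_ge0.
- by move=> x; rewrite z0 z1 subr0 addr0 ger0_norm ?sqr_ge0// lerDr sqr_ge0.
Qed.

Lemma ae_zero_costr A t : L1 A -> {ae mu, forall w, A w = 0} -> costr A t = 0.
Proof.
move=> LA A0; rewrite /costr (@ae_eq_int _ _ (cst 0)).
- by rewrite Rintegral_cst//= mul0r.
- exact: L1_measurable (L1_cos t LA).
- exact: measurable_cst.
- by apply: negligibleS A0 => w /= ne H; apply: ne; rewrite H mul0r.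
Qed.

Lemma ae_zero_sintr A t : L1 A -> {ae mu, forall w, A w = 0} -> sintr A t = 0.
Proof.
move=> LA A0; rewrite /sintr (@ae_eq_int _ _ (cst 0)).
- by rewrite Rintegral_cst//= mul0r.
- exact: L1_measurable (L1_sin t LA).
- exact: measurable_cst.
- by apply: negligibleS A0 => w /= ne H; apply: ne; rewrite H mul0r.
Qed.

Lemma int_le0_ae (Q : R -> R) : L1 Q -> (forall w, 0 <= Q w) ->
  \int[mu]_w Q w <= 0 -> {ae mu, forall w, Q w = 0}.
Proof.
move=> LQ Q0 IQ.
have I0 : \int[mu]_w Q w = 0 by apply/eqP; rewrite eq_le IQ int_ge0.
have mQ : measurable_fun setT (EFin \o Q) by exact: measurable_int LQ.
have [Q_ae _] := ae_eq_integral_abs mu measurableT mQ.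
apply: negligibleS (Q_ae _) => [w /= ne H|].
  by apply: ne; case: (H I).
rewrite -[RHS]/(0%:E) -I0 EFin_int//.
by apply: eq_integral => w _ /=; rewrite ger0_norm.
Qed.

Lemma freq_mul2 A (w : R) : freq_mul (freq_mul A) w = (2 * pi * w) ^+ 2 * A w.
Proof. by rewrite /freq_mul; ring. Qed.

(** Here s is sigma^-2; p, q are the integrals of f1''^2, f2''^2; m is that of M1^2 + M2^2; a1, b1
    are the integrals of f1 against costr M1, sintr M2, and c2, d2 those of f2 against sintr M1,
    costr M2. The two parentheses in the conclusion are int g1 M1 and int g2 M2. *)
Let energy_balance (s a1 b1 c2 d2 p q m : R) :
  0 <= s * p + (b1 - a1) -> 0 <= s * q + - (c2 + d2) -> s * (p + q) <= s * m ->
  (a1 + c2) + (d2 - b1) - s * m <= 0.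
Proof. lra. Qed.

Variables (sigma : R) (x : int -> R).
Hypothesis sigma0 : 0 < sigma.
Hypothesis hx : forall i : int, x i < x (i + 1).
Hypothesis hgap : forall i : int, x (i + 1) - x i <= 2 * pi / sigma.

Let a := sigma / (2 * pi).

Let a0 : 0 < a.
Proof. by rewrite divr_gt0// mulr_gt0// pi_gt0. Qed.

Let pia : 2 * pi * a = sigma.
Proof. by rewrite /a mulrCA divff ?mulr1// mulf_neq0// lt0r_neq0// pi_gt0. Qed.

Variables (f1 f2 g1 g2 : R -> R).
Hypothesis pairing : forall A, L1 A -> Lsq A -> Lsq (costr A) -> Lsq (sintr A) ->
  \int[mu]_w (g1 w * A w) =
    \int[mu]_x (f1 x * costr A x) + \int[mu]_x (f2 x * sintr A x) /\
  \int[mu]_w (g2 w * A w) =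
    \int[mu]_x (f2 x * costr A x) - \int[mu]_x (f1 x * sintr A x).
Hypotheses (cf1 : continuous f1) (cf2 : continuous f2).
Hypotheses (Lf1 : Lsq f1) (Lf2 : Lsq f2) (bg1 : band a g1) (bg2 : band a g2).
Hypotheses (Lg1 : Lsq g1) (Lg2 : Lsq g2).

Let N1 := freq_mul g1.
Let N2 := freq_mul g2.
Let M1 := freq_mul N1.
Let M2 := freq_mul N2.
Let bN1 : band a N1 := band_freq_mul bg1.
Let bN2 : band a N2 := band_freq_mul bg2.
Let bM1 : band a M1 := band_freq_mul bN1.
Let bM2 : band a M2 := band_freq_mul bN2.
Let LM1 : Lsq M1 := Lsq_freq_mul a0 bN1 (Lsq_freq_mul a0 bg1 Lg1).
Let LM2 : Lsq M2 := Lsq_freq_mul a0 bN2 (Lsq_freq_mul a0 bg2 Lg2).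

Let f1E t : f1 t = costr g1 t - sintr g2 t.
Proof. exact: (inversion_re pairing cf1 Lf1 bg1.1 bg2.1 bg1.2 bg2.2). Qed.

Let f2E t : f2 t = sintr g1 t + costr g2 t.
Proof. exact: (inversion_im pairing cf2 Lf2 bg1.1 bg2.1 bg1.2 bg2.2). Qed.

(** The signs are left in the form in which the differentiation rules produce them. *)
Let f1' t := - sintr N1 t - costr N2 t.
Let f2' t := costr N1 t + - sintr N2 t.
Let f1'' t := - costr M1 t - - sintr M2 t.
Let f2'' t := - sintr M1 t + - costr M2 t.

Let df1 (t : R) : is_derive t 1 f1 (f1' t).
Proof.
rewrite (_ : f1 = fun t => costr g1 t - sintr g2 t); last exact/funext/f1E.
apply: is_derive1B; first exact: is_derive_costr bg1.1 bN1.1.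
exact: is_derive_sintr bg2.1 bN2.1.
Qed.

Let df2 (t : R) : is_derive t 1 f2 (f2' t).
Proof.
rewrite (_ : f2 = fun t => sintr g1 t + costr g2 t); last exact/funext/f2E.
apply: is_derive1D; first exact: is_derive_sintr bg1.1 bN1.1.
exact: is_derive_costr bg2.1 bN2.1.
Qed.

Let df1' (t : R) : is_derive t 1 f1' (f1'' t).
Proof.
apply: is_derive1B; last exact: is_derive_costr bN2.1 bM2.1.
exact: (is_deriveN (is_derive_sintr t bN1.1 bM1.1)).
Qed.

Let df2' (t : R) : is_derive t 1 f2' (f2'' t).
Proof.
apply: is_derive1D; first exact: is_derive_costr bN1.1 bM1.1.
exact: (is_deriveN (is_derive_sintr t bN2.1 bM2.1)).
Qed.

Let cf1'' : continuous f1''.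
Proof.
apply: continuous_fB => t; apply: cvgN.
  exact: (continuous_costr bM1.1).
exact: (continuous_sintr bM2.1).
Qed.

Let cf2'' : continuous f2''.
Proof.
apply: continuous_fD => t; apply: cvgN.
  exact: (continuous_sintr bM1.1).
exact: (continuous_costr bM2.1).
Qed.

Hypothesis zf1 : forall i, f1 (x i) = 0 /\ derive1 f1 (x i) = 0.
Hypothesis zf2 : forall i, f2 (x i) = 0 /\ derive1 f2 (x i) = 0.

Let uniqueness_bounded :
  ~ ((forall t, exists i, t < x i) /\ (forall t, exists i, x i < t)) ->
  forall t, f1 t = 0 /\ f2 t = 0.
Proof.
move=> bnd t; split.
- have [b zb] := bounded_int_seq_clusters hx (fun i => (zf1 i).1) bnd.
  have E y : f1 y = costr g1 y + sintr (fun w => - g2 w) y.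
    by rewrite f1E sintrN//; exact: bg2.1.
  rewrite E; apply: (@band_clustering_zeros _ a a0 _ _ b) => //; first exact: bandN.
  by rewrite (_ : (fun _ => _) = f1)//; apply/funext => y; rewrite E.
- have [b zb] := bounded_int_seq_clusters hx (fun i => (zf2 i).1) bnd.
  have E y : f2 y = costr g2 y + sintr g1 y by rewrite f2E addrC.
  rewrite E; apply: (@band_clustering_zeros _ a a0 _ _ b) => //.
  by rewrite (_ : (fun _ => _) = f2)//; apply/funext => y; rewrite E.
Qed.

Let sigma_neq0 : sigma != 0 := lt0r_neq0 sigma0.

Let energy_gap w : 0 <= (g1 w * M1 w + g2 w * M2 w) -
  sigma ^- 2 * (M1 w ^+ 2 + M2 w ^+ 2).
Proof.
rewrite /M1 /M2 /N1 /N2 !freq_mul2; set m := (2 * pi * w) ^+ 2.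
rewrite [leRHS](_ : _ = m * (1 - m / sigma ^+ 2) * (g1 w ^+ 2 + g2 w ^+ 2)); last first.
  by field.
have [wa|wa] := ltP a `|w|; first by rewrite bg1.2// bg2.2// expr0n addr0 mulr0.
apply: mulr_ge0; last by rewrite addr_ge0 ?sqr_ge0.
apply: mulr_ge0; first exact: sqr_ge0.
rewrite subr_ge0 ler_pdivrMr ?exprn_gt0// mul1r -pia /m.
rewrite [leLHS]exprMn [leRHS]exprMn ler_wpM2l ?sqr_ge0//.
by rewrite -(real_normK (num_real w)) lerXn2r ?nnegrE// ltW.
Qed.

(** The factor in front of g^2 vanishes only at w = 0, a and -a, a null set. This settles the
    critical case of gaps equal to 2 pi / sigma. *)
Let ae_spectrum_zero (g : R -> R) :
  (forall w, a < `|w| -> g w = 0) ->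
  {ae mu, forall w, (2 * pi * w) ^+ 2 * (1 - (2 * pi * w) ^+ 2 / sigma ^+ 2) *
    g w ^+ 2 = 0} -> {ae mu, forall w, g w = 0}.
Proof.
move=> sg ae0.
have n1 (b : R) : mu.-negligible [set b].
  by apply: (negligibleP mu (measurable_set1 b)).2; exact: lebesgue_measure_set1.
apply: negligibleS (negligibleU ae0 (negligibleU (n1 0)
  (negligibleU (n1 a) (n1 (- a))))) => w /= gw.
have [->|w0] := eqVneq w 0; first by right; left.
have [->|wa] := eqVneq w a; first by right; right; left.
have [->|wNa] := eqVneq w (- a); first by right; right; right.
left => /= /eqP; rewrite !mulf_eq0 pnatr_eq0 (gt_eqF (pi_gt0 R)) (negPf w0) /=.
rewrite orbb subr_eq0 => /orP[|/eqP //].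
rewrite eq_sym -(inj_eq (mulIf (expf_neq0 2 sigma_neq0))).
rewrite mul1r divfK ?expf_neq0// -pia [X in X == _]exprMn [X in _ == X]exprMn.
have p0 : (2 * pi) ^+ 2 != 0 :> R by rewrite expf_neq0// lt0r_neq0// mulr_gt0// pi_gt0.
by rewrite (inj_eq (mulfI p0)) eqf_sqr (negPf wa) (negPf wNa).
Qed.

Let uniqueness_unbounded :
  (forall t, exists i, t < x i) -> (forall t, exists i, x i < t) ->
  forall t, f1 t = 0 /\ f2 t = 0.
Proof.
move=> ub lb.
have [LC1 LS1] := Lsq_trig bM1.1 LM1; have [LC2 LS2] := Lsq_trig bM2.1 LM2.
have [LG IG] := trig_plancherel_le bM1.1 LM1 bM2.1 LM2.
have cmeas (f : R -> R) : continuous f -> measurable_fun setT f.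
  exact: continuous_measurable_fun.
have mf1'' := cmeas _ cf1''; have mf2'' := cmeas _ cf2''.
have L1f1 : L1 (fun t => f1'' t ^+ 2).
  apply: L1_le LG => [|t]; first exact: measurable_funX.
  rewrite ger0_norm ?sqr_ge0// (_ : f1'' t ^+ 2 = (costr M1 t - sintr M2 t) ^+ 2).
    by rewrite lerDl sqr_ge0.
  by rewrite /f1''; ring.
have L1f2 : L1 (fun t => f2'' t ^+ 2).
  apply: L1_le LG => [|t]; first exact: measurable_funX.
  rewrite ger0_norm ?sqr_ge0// (_ : f2'' t ^+ 2 = (sintr M1 t + costr M2 t) ^+ 2).
    by rewrite lerDr sqr_ge0.
  by rewrite /f2''; ring.
have Lff1 : L1 (fun t => f1 t * f1'' t) by apply: sqr_L1M => //; [exact: Lf1.1|exact: Lf1.2].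
have Lff2 : L1 (fun t => f2 t * f2'' t) by apply: sqr_L1M => //; [exact: Lf2.1|exact: Lf2.2].
have k1 : 0 <= \int[mu]_t (sigma ^- 2 * f1'' t ^+ 2 + f1 t * f1'' t).
  apply: (int_ge0_of_segments hx _ _ ub lb); first by apply: L1D => //; exact: L1Z.
  have z' i : f1' (x i) = 0 by have [_] := zf1 i; rewrite derive1E; have [_ ->] := df1 (x i).
  move=> i; exact: (clamped_segment (hx i) sigma0 (hgap i) df1 df1' cf1''
    (zf1 i).1 (zf1 _).1 (z' i) (z' _)).
have k2 : 0 <= \int[mu]_t (sigma ^- 2 * f2'' t ^+ 2 + f2 t * f2'' t).
  apply: (int_ge0_of_segments hx _ _ ub lb); first by apply: L1D => //; exact: L1Z.
  have z' i : f2' (x i) = 0 by have [_] := zf2 i; rewrite derive1E; have [_ ->] := df2 (x i).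
  move=> i; exact: (clamped_segment (hx i) sigma0 (hgap i) df2 df2' cf2''
    (zf2 i).1 (zf2 _).1 (z' i) (z' _)).
rewrite RintegralD// in k1; last exact: L1Z.
rewrite RintegralZl// in k1.
rewrite RintegralD// in k2; last exact: L1Z.
rewrite RintegralZl// in k2.
(* Plancherel's identity for f and f'': the real equation at [M1] and the imaginary one at [M2] add
   up to int (g1 M1 + g2 M2) = - int (f1 f1'' + f2 f2''). *)
have [p1 _] := pairing bM1.1 LM1 LC1 LS1.
have [_ p2] := pairing bM2.1 LM2 LC2 LS2.
have e1 : \int[mu]_t (f1 t * f1'' t) =
    \int[mu]_t (f1 t * sintr M2 t) - \int[mu]_t (f1 t * costr M1 t).
  have h1 : L1 (fun t => f1 t * costr M1 t).
    by apply: sqr_L1M; [exact: Lf1.1|exact: LC1.1|exact: Lf1.2|exact: LC1.2].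
  have h2 : L1 (fun t => f1 t * sintr M2 t).
    by apply: sqr_L1M; [exact: Lf1.1|exact: LS2.1|exact: Lf1.2|exact: LS2.2].
  rewrite -RintegralB//; apply: eq_int => t; rewrite /f1''; ring.
have e2 : \int[mu]_t (f2 t * f2'' t) =
    - (\int[mu]_t (f2 t * sintr M1 t) + \int[mu]_t (f2 t * costr M2 t)).
  have h1 : L1 (fun t => f2 t * sintr M1 t).
    by apply: sqr_L1M; [exact: Lf2.1|exact: LS1.1|exact: Lf2.2|exact: LS1.2].
  have h2 : L1 (fun t => f2 t * costr M2 t).
    by apply: sqr_L1M; [exact: Lf2.1|exact: LC2.1|exact: Lf2.2|exact: LC2.2].
  rewrite -RintegralD// -mulN1r -RintegralZl//; last exact: L1D.
  by apply: eq_int => t; rewrite /f2''; ring.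
have e3 : \int[mu]_t (f1'' t ^+ 2) + \int[mu]_t (f2'' t ^+ 2) <=
    \int[mu]_w (M1 w ^+ 2) + \int[mu]_w (M2 w ^+ 2).
  apply: le_trans IG; rewrite -RintegralD// le_eqVlt; apply/orP; left; apply/eqP.
  by apply: eq_int => t; rewrite /f1'' /f2''; ring.
have Lg1M : L1 (fun w => g1 w * M1 w).
  by apply: sqr_L1M; [exact: Lg1.1|exact: LM1.1|exact: Lg1.2|exact: LM1.2].
have Lg2M : L1 (fun w => g2 w * M2 w).
  by apply: sqr_L1M; [exact: Lg2.1|exact: LM2.1|exact: Lg2.2|exact: LM2.2].
pose Q w := (g1 w * M1 w + g2 w * M2 w) - sigma ^- 2 * (M1 w ^+ 2 + M2 w ^+ 2).
have LMM : L1 (fun w => M1 w ^+ 2 + M2 w ^+ 2).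
  by apply: L1D; [exact: LM1.2|exact: LM2.2].
have LgM := L1D Lg1M Lg2M.
have LQ : L1 Q by apply: L1B => //; exact: L1Z.
have IQ : \int[mu]_w Q w <= 0.
  rewrite RintegralB//; last exact: L1Z.
  rewrite RintegralD// RintegralZl// RintegralD//; [|exact: LM1.2|exact: LM2.2].
  rewrite p1 p2.
  have s2 : 0 <= sigma ^- 2 by rewrite invr_ge0 exprn_ge0// ltW.
  rewrite e1 in k1; rewrite e2 in k2.
  exact: energy_balance k1 k2 (ler_wpM2l s2 e3).
have Q0 := int_le0_ae LQ energy_gap IQ.
have QE w : Q w = (2 * pi * w) ^+ 2 * (1 - (2 * pi * w) ^+ 2 / sigma ^+ 2) *
    (g1 w ^+ 2 + g2 w ^+ 2).
  by rewrite /Q /M1 /M2 /N1 /N2 !freq_mul2; field.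
(* The vanishing integrand contains |g|^2, so [ae_spectrum_zero] is applied to |g| itself. *)
have sum_ae : {ae mu, forall w, Num.sqrt (g1 w ^+ 2 + g2 w ^+ 2) = 0}.
  apply: ae_spectrum_zero => [w wa|].
    by rewrite bg1.2// bg2.2// expr0n addr0 sqrtr0.
  apply: negligibleS Q0 => w /= ne H; apply: ne.
  by rewrite sqr_sqrtr ?addr_ge0 ?sqr_ge0// -QE.
have sq (p q : R) : Num.sqrt (p ^+ 2 + q ^+ 2) = 0 -> p = 0 /\ q = 0.
  move/eqP; rewrite sqrtr_eq0 => h.
  have : p ^+ 2 + q ^+ 2 == 0 by rewrite eq_le h addr_ge0 ?sqr_ge0.
  by rewrite paddr_eq0 ?sqr_ge0// !sqrf_eq0 => /andP[/eqP-> /eqP->].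
have z1 : {ae mu, forall w, g1 w = 0}.
  by apply: negligibleS sum_ae => w /= ne /sq[H _]; exact: ne.
have z2 : {ae mu, forall w, g2 w = 0}.
  by apply: negligibleS sum_ae => w /= ne /sq[_ H]; exact: ne.
have [L1g1 _] := bg1; have [L1g2 _] := bg2.
move=> t; rewrite f1E f2E !ae_zero_costr// !ae_zero_sintr//.
by rewrite subr0 addr0.
Qed.

Lemma double_zeros_uniqueness t : f1 t = 0 /\ f2 t = 0.
Proof.
have [[ub lb]|bnd] := pselect
  ((forall t, exists i, t < x i) /\ (forall t, exists i, x i < t)).
- exact: uniqueness_unbounded.
- exact: uniqueness_bounded.
Qed.

End Uniqueness.

(** * Restriction of the spectrum to the band *)

Section Truncation.
Variable R : realType.
Local Notation mu := (@lebesgue_measure R).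
Local Notation L1 f := (mu.-integrable setT (EFin \o f)).
Local Notation Lsq A := (measurable_fun setT A /\ L1 (fun x => A x ^+ 2)).

(** The essential support condition makes the spectrum vanish off the band almost everywhere only,
    while [band] asks for it pointwise. Truncation repairs this, and on a bounded interval square
    integrability also gives integrability. *)
Definition truncate (a : R) (A : R -> R) (w : R) : R := A w * \1_`[- a, a] w.

Lemma Lsq_truncate (a : R) (A : R -> R) : Lsq A -> Lsq (truncate a A) /\ band a (truncate a A).
Proof.
move=> [mA LA].
have mI : measurable_fun setT (\1_`[- a, a] : R -> R) by exact: measurable_indic.
have mT : measurable_fun setT (truncate a A) by exact: measurable_funM.
have I01 (w : R) : 0 <= (\1_`[- a, a] w : R) <= 1.
  by rewrite indicE; case: (_ \in _); rewrite /= ?lexx ?ler01.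
split; split => //.
- apply: L1_le LA; first exact: measurable_funX.
  move=> w; have /andP[h0 h1] := I01 w.
  by rewrite ger0_norm ?sqr_ge0// exprMn ler_piMr ?sqr_ge0// exprn_ile1.
- have LI : L1 (\1_`[- a, a] : R -> R) by exact: integrable_indic_itv.
  apply: (L1_le mT _ (L1D LA LI)) => w; have /andP[h0 h1] := I01 w.
  rewrite normrM (ger0_norm h0) -(real_normK (num_real (A w))).
  rewrite indicE; case: (_ \in _); rewrite /= ?mulr0 ?mulr1 ?addr0 ?sqr_ge0//.
  rewrite real_normK ?num_real//; exact: normr_le_sqrD1.
- move=> w wa; rewrite /truncate indicE memNset ?mulr0//= in_itv/= -ler_norml.
  by rewrite leNgt wa.
Qed.

End Truncation.

Theorem corollary3p3 (R : realType) (sigma : R) (x : int -> R)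
    (hsigma : 0 < sigma)
    (hx : forall i : int, x i < x (i + 1))
    (hgap : (ereal_sup (range (fun i : int => (x (i + 1) - x i)%:E))
               <= (2 * pi / sigma)%:E)%E) :
  uniqueness_set_order1 (range x) (bandlimited sigma).
Proof.
move=> f [[cf1 cf2] [g fg gsupp]] zf.
set a := sigma / (2 * pi) in gsupp.
have gap i : x (i + 1) - x i <= 2 * pi / sigma.
  by rewrite -lee_fin; apply: le_trans hgap; apply: ereal_sup_ubound; exists i.
have [[/Lfun2_Lsq Lf1 /Lfun2_Lsq Lf2] [/Lfun2_Lsq Lg1 /Lfun2_Lsq Lg2] _] := fg.
have [LG1 bG1] := Lsq_truncate a Lg1; have [LG2 bG2] := Lsq_truncate a Lg2.
have gae : {ae (@lebesgue_measure R), forall w, ~ `[- a, a]%classic w -> g w = 0}.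
  apply: negligibleS (ess_support_ae g) => w /= ne H; apply: ne => wa.
  by apply: H => /gsupp.
(* [c] stands for the real or the imaginary part. *)
have tr (c : R[i] -> R) : c 0 = 0 ->
    {ae (@lebesgue_measure R), forall w, truncate a (fun w => c (g w)) w = c (g w)}.
  move=> c0; apply: negligibleS gae => w /= ne H; apply: ne.
  rewrite /truncate indicE; have [wa|wa] := boolP (w \in _); first by rewrite mulr1.
  by rewrite H ?c0 ?mul0r// => wa'; move: wa; rewrite mem_set.
have trint (c : R[i] -> R) A : c 0 = 0 ->
    measurable_fun setT (truncate a (fun w => c (g w))) ->
    measurable_fun setT (fun w => c (g w)) -> measurable_fun setT A ->
    \int[@lebesgue_measure R]_w (truncate a (fun w => c (g w)) w * A w) =
    \int[@lebesgue_measure R]_w (c (g w) * A w).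
  move=> c0 mT mc mA; apply: ae_eq_int.
  - exact: measurable_funM.
  - exact: measurable_funM.
  - by apply: negligibleS (tr c c0) => w /= ne H; apply: ne; rewrite H.
have uniq := @double_zeros_uniqueness R sigma x hsigma hx gap (cRe f) (cIm f)
  (truncate a (cRe g)) (truncate a (cIm g)) _ cf1 cf2 Lf1 Lf2 bG1 bG2 LG1 LG2.
have {}zf i : f (x i) = 0 /\ cderive f (x i) = 0 by apply: zf; exists i.
move=> t; have [|||r1 r2] := uniq _ _ _ t.
- move=> A LA [mA LA2] LC LS.
  rewrite (trint (@complex.Re R) A erefl LG1.1 Lg1.1 mA).
  rewrite (trint (@complex.Im R) A erefl LG2.1 Lg2.1 mA).
  exact: fourierL2_pairing.
- move=> i; have [fz] := zf i; rewrite /cderive /cRe fz => -[h _].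
  by split.
- move=> i; have [fz] := zf i; rewrite /cderive /cIm fz => -[_ h].
  by split.
by move: r1 r2; rewrite /cRe /cIm; case: (f t) => p q /= -> ->.
Qed.
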